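(* Let $T$ be an edge-weighted (bounded-degree) tree with a set of marked vertices, and let root be the root cluster of its RC tree. Then $\textsc{ExpandCluster}(\mathrm{root})$ returns the compressed path tree of $T$ with respect to the marked vertices.
   Context: Compressed path tree: given an edge-weighted tree and a set $S$ of marked vertices, take the subgraph formed by the union of the tree paths between all pairs of marked vertices, and then repeatedly splice out every unmarked vertex of degree two (replacing its two incident edges by a single edge). Each edge of the result is labeled with the weight of the heaviest edge of the original tree on the path it represents. RC tree: a recursive clustering of the tree $T$ produced by tree contraction. A cluster is a connected subset of the vertices and edges of $T$ (a cluster may contain an edge without containing its endpoints). The boundary vertices of a cluster $C$ are the vertices $v\notin C$ that are an endpoint of some edge in $C$; every cluster has at most two boundary vertices, and is called nullary, unary or binary accordingly. The leaves of the RC tree are the single-vertex clusters and single-edge clusters of $T$. Every non-leaf cluster is the disjoint union of its children (constantly many), exactly one of which is a single vertex, called the representative of $C$; the boundary vertices of the children of $C$ are precisely the boundary vertices of $C$ together with the representative of $C$. The root cluster is nullary (has no boundary vertices). For a binary cluster $C$, $\mathrm{Weight}(C)$ is the weight of the heaviest edge of $T$ on the path between its two boundary vertices. A cluster is marked if it contains a marked vertex. SpliceOut$(G,v)$: if $v$ has degree two in $G$ and is unmarked, replace its two incident edges by a single edge between its neighbors with weight equal to the larger of the two weights, and delete $v$; otherwise do nothing. Prune$(G,v)$: if $v$ has degree two, return SpliceOut$(G,v)$; else if $v$ has degree one with neighbor $u$ and $v$ is unmarked, remove $v$ and the edge $(u,v)$ obtaining $G'$, and return SpliceOut$(G',u)$;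 otherwise return $G$. ExpandCluster$(C)$: if $C$ is unmarked, then if $C$ is binary return the graph with vertex set the two boundary vertices of $C$ and a single edge between them of weight $\mathrm{Weight}(C)$, and otherwise return the graph with vertex set the boundary vertices of $C$ and no edges. Else, if $C$ is a single vertex $v$, return the graph $(\{v\},\emptyset)$. Otherwise, let $G$ be the union (of vertex sets and of edge sets) of ExpandCluster$(c)$ over all children $c$ of $C$, and return Prune$(G, \text{representative of } C)$. *)

(* Defs.v *)
(* MathComp world. *)
From HB Require Import structures.
From mathcomp Require Import all_boot all_order.
From mathcomp Require Import finmap.

Set Implicit Arguments.
Unset Strict Implicit.
Unset Printing Implicit Defensive.

Section Tree.

Variables (V : finType) (E : {set {set V}}).

(* An edge is the set of its endpoints. *)
Definition adj : rel V := fun x y => (x != y) && ([set x; y] \in E).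

Definition degree (v : V) : nat := #|[set e in E | v \in e]|.

(* A nonempty connected acyclic simple graph with vertex set V; a [ucycle] of
   size 2 runs back and forth along one edge and is not a cycle of the graph. *)
Definition is_tree : Prop :=
  [/\ 0 < #|V|,
      (forall e, e \in E -> #|e| = 2),
      (forall x y, connect adj x y)
    & (forall c, ucycle adj c -> size c <= 2)].

Definition simple_path (x y : V) (p : seq V) : bool :=
  [&& path adj x p, last x p == y & uniq (x :: p)].

(* The vertices, in order, of the tree path from x to y. *)
Definition tpath (x y : V) : seq V :=
  if [pick p : #|V|.-bseq V | simple_path x y p] is Some p then x :: p
  else [::].

Definition tpath_edges (x y : V) : seq {set V} :=
  if tpath x y is z :: p then pairmap (fun a b => [set a; b]) z p else [::].

End Tree.

(* The weight of the heaviest edge on the tree path between x and y, for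
   B = [set x; y] with x != y.  The path is then nonempty, so that the initial
   value of the maximum is the weight of one of its edges; W need not have a
   least element. *)
Definition heaviest (V : finType) (d : Order.disp_t) (W : orderType d)
    (E : {set {set V}}) (w : {set V} -> W) (B : {set V}) : W :=
  let s := if enum B is [:: x; y] then tpath_edges E x y else [::] in
  \big[Order.max / w (head B s)]_(f <- s) w f.

(* Weighted graphs on vertices taken from V.  Parallel edges carrying different
   weights are kept apart. *)
Record wgraph (V : finType) (d : Order.disp_t) (W : orderType d) := WGraph {
  gverts : {set V};
  gedges : {fset {set V} * W} }.

Record ugraph (V : finType) := UGraph {
  uverts : {set V};
  uedges : {set {set V}} }.

Section CompressedPathTree.

Variables (V : finType) (d : Order.disp_t) (W : orderType d).
Variables (E : {set {set V}}) (w : {set V} -> W) (S : {set V}).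

(* A vertex is joined to itself by the trivial path, so a sole marked vertex
   belongs to the union. *)
Definition path_union : ugraph V :=
  UGraph (\bigcup_(x in S) \bigcup_(y in S) [set z in tpath E x y])
         (\bigcup_(x in S) \bigcup_(y in S) [set f in tpath_edges E x y]).

Definition uincident (G : ugraph V) (v : V) : {set {set V}} :=
  [set e in uedges G | v \in e].

Definition spliceable (G : ugraph V) (v : V) : bool :=
  [&& v \in uverts G, v \notin S & #|uincident G v| == 2].

(* The edges [set a; v] and [set v; b] become [set a; b]. *)
Definition usplice (G : ugraph V) (v : V) : ugraph V :=
  UGraph (uverts G :\ v)
         ((cover (uincident G v) :\ v) |: (uedges G :\: uincident G v)).

Inductive splices_out : ugraph V -> ugraph V -> Prop :=
| SpliceDone G : (forall v, ~~ spliceable G v) -> splices_out G G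
| SpliceStep G v H :
    spliceable G v -> splices_out (usplice G v) H -> splices_out G H.

Definition label (G : ugraph V) : wgraph V W :=
  WGraph (uverts G) [fset (e, heaviest E w e) | e in uedges G]%fset.

Definition compressed_path_tree (G : wgraph V W) : Prop :=
  exists2 H : ugraph V, splices_out path_union H & G = label H.

End CompressedPathTree.

(* The list of an RCNode holds all its children, including the representative,
   which is also recorded as the first argument. *)
Inductive rctree (V : finType) :=
| RCVertex of V
| RCEdge of {set V}
| RCNode of V & seq (rctree V).

Section RCTree.

Variables (V : finType) (E : {set {set V}}).

Definition vertex_leaf (c : rctree V) : option V :=
  if c is RCVertex v then Some v else None.

(* The cluster itself, a set of vertices (inl) and of edges (inr). *)
Fixpoint cluster (c : rctree V) : {set V + {set V}} :=
  match c with
  | RCVertex v => [set inl v]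
  | RCEdge e => [set inr e]
  | RCNode _ cs => foldr (@setU _) set0 (map cluster cs)
  end.

Definition boundary (X : {set V + {set V}}) : {set V} :=
  [set v | (inl v \notin X) && [exists e : {set V}, (inr e \in X) && (v \in e)]].

Definition incidence : rel (V + {set V}) := fun a b =>
  match a, b with
  | inl v, inr e | inr e, inl v => v \in e
  | _, _ => false
  end.

(* An edge of X and an endpoint of it are linked only if the endpoint is in X. *)
Definition connected_cluster (X : {set V + {set V}}) : Prop :=
  forall a b, a \in X -> b \in X ->
    connect [rel u v | [&& u \in X, v \in X & incidence u v]] a b.

Definition is_cluster (X : {set V + {set V}}) : Prop :=
  connected_cluster X /\ #|boundary X| <= 2.

(* k bounds the number of children of a cluster. *)
Fixpoint rc_clustering (k : nat) (c : rctree V) : Prop :=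
  is_cluster (cluster c) /\
  match c with
  | RCVertex _ => True
  | RCEdge e => e \in E
  | RCNode v cs =>
      [/\ size cs <= k,
          pmap vertex_leaf cs = [:: v],
          pairwise (fun X Y : {set V + {set V}} => [disjoint X & Y])
            (map cluster cs),
          \bigcup_(D <- cs) boundary (cluster D) = v |: boundary (cluster c)
        & foldr and True (map (rc_clustering k) cs)]
  end.

Definition is_rc_tree (k : nat) (root : rctree V) : Prop :=
  [/\ rc_clustering k root,
      boundary (cluster root) = set0,
      (forall v, inl v \in cluster root)
    & (forall e, e \in E -> inr e \in cluster root)].

End RCTree.

Section ExpandCluster.

Local Open Scope fset_scope.

Variables (V : finType) (d : Order.disp_t) (W : orderType d).
Variables (E : {set {set V}}) (w : {set V} -> W) (S : {set V}).

Definition gempty : wgraph V W := WGraph set0 fset0.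

Definition gunion (G H : wgraph V W) : wgraph V W :=
  WGraph (gverts G :|: gverts H) (gedges G `|` gedges H).

Definition incident (G : wgraph V W) (v : V) : {fset {set V} * W} :=
  [fset e in gedges G | v \in e.1].

Definition splice_out (G : wgraph V W) (v : V) : wgraph V W :=
  if enum_fset (incident G v) is [:: e; f] then
    if v \notin S then
      WGraph (gverts G :\ v)
        (((e.1 :|: f.1) :\ v, Order.max e.2 f.2)
           |` (gedges G `\` incident G v))
    else G
  else G.

Definition prune (G : wgraph V W) (v : V) : wgraph V W :=
  match enum_fset (incident G v) with
  | [:: _; _] => splice_out G v
  | [:: e] =>
      if v \notin S then
        let G' := WGraph (gverts G :\ v) (gedges G `\ e) in
        if [pick u in e.1 :\ v] is Some u then splice_out G' u else G'
      else G
  | _ => G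
  end.

Definition marked_cluster (X : {set V + {set V}}) : bool :=
  [exists v in S, inl v \in X].

(* A single edge contains no vertex, hence is never marked: the value given to
   a marked RCEdge is irrelevant. *)
Fixpoint expand_cluster (c : rctree V) : wgraph V W :=
  let B := boundary (cluster c) in
  if ~~ marked_cluster (cluster c) then
    if #|B| == 2 then WGraph B [fset (B, heaviest E w B)] else WGraph B fset0
  else
    match c with
    | RCVertex v => WGraph [set v] fset0
    | RCEdge _ => gempty
    | RCNode v cs => prune (foldr gunion gempty (map expand_cluster cs)) v
    end.

End ExpandCluster.

(* Main.v *)
(* Call the marked vertices in a cluster C together with its boundary vertices the
   terminals of C. For a set A of terminals let K be the set of medians of triples
   of A, i.e. A with its branching vertices, and let skel K join two vertices of K
   whenever no other vertex of K lies on the path between them. Then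
   ExpandCluster(C) is skel K for the terminals of C. Indeed distinct children of C
   are separated by the representative v, so the union of their skeletons is the
   skeleton for the terminals of C with v added. If v is unmarked, the number of
   its neighbours decides what removing it from the terminals does: with three or
   more it stays as a branching vertex, with two it is spliced out, and with one it
   disappears, after which its neighbour may cease to branch. This is Prune.
   At the root the terminals are the marked vertices. On the other side, the union
   of the paths between marked vertices is the skeleton of its own vertex set, and
   splicing out an unmarked vertex of degree two amounts to deleting it from this
   set; when that is no longer possible exactly the medians are left. *)

Require Import Defs.
From mathcomp Require Import all_boot all_order.
From mathcomp Require Import finmap.

Set Implicit Arguments.
Unset Strict Implicit.
Unset Printing Implicit Defensive.

(** * Unions and maxima over sequences *)

Lemma bigcup_seqP (J : eqType) (s : seq J) (U : finType) (G : J -> {set U}) (x : U) :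
  reflect (exists2 j, j \in s & x \in G j) (x \in \bigcup_(j <- s) G j).
Proof.
elim: s => [|j s IHs]; first by rewrite big_nil inE; constructor=> -[].
rewrite big_cons inE; apply: (iffP orP) => [[xj|/IHs[i is_ xi]]|[i]].
- by exists j; rewrite ?mem_head.
- by exists i; rewrite // inE is_ orbT.
- by rewrite inE => /orP[/eqP->|is_ xi]; [left | right; apply/IHs; exists i].
Qed.

(** [W] may lack a least element, so the initial value [x0] can itself be the maximum; the last part
    therefore lists it among the candidates. *)
Lemma bigmax_seq (T : eqType) (d : Order.disp_t) (W : orderType d)
    (f : T -> W) (x0 : W) (s : seq T) :
    (x0 <= \big[Order.max/x0]_(x <- s) f x)%O
  /\ (forall x, x \in s -> (f x <= \big[Order.max/x0]_(x <- s) f x)%O)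
  /\ \big[Order.max/x0]_(x <- s) f x \in x0 :: map f s.
Proof.
elim: s => [|a s [IH0 [IHub IHin]]]; first by rewrite big_nil mem_head.
rewrite big_cons; split; first by rewrite Order.TotalTheory.le_max IH0 orbT.
split=> [x|].
  rewrite inE Order.TotalTheory.le_max => /orP[/eqP->|/IHub->]; last exact: orbT.
  by rewrite Order.POrderTheory.lexx.
rewrite !inE in IHin *; case: Order.TotalTheory.leP => _; last by rewrite eqxx orbT.
by case/orP: IHin => ->; rewrite ?orbT.
Qed.

(** * Paths in a tree *)

Section TreePaths.

Variables (V : finType) (E : {set {set V}}).
Hypothesis treeE : is_tree E.

Implicit Types (x y z : V) (p q : seq V).

Lemma adj_sym : symmetric (adj E).
Proof. by move=> x y; rewrite /adj eq_sym setUC. Qed.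

Lemma adj_neq x y : adj E x y -> x != y.
Proof. by case/andP. Qed.

Lemma path_adj_rev x p : path (adj E) (last x p) (rev (belast x p)) = path (adj E) x p.
Proof. by rewrite rev_path; apply: eq_path => a b; rewrite adj_sym. Qed.

Lemma simple_path_rev x y p :
  simple_path E x y p -> simple_path E y x (rev (belast x p)).
Proof.
case/and3P=> pp /eqP lp up; apply/and3P; split.
- by rewrite -lp path_adj_rev.
- by case: p {pp up} lp => [<- //|a p] lp /=; rewrite rev_cons last_rcons.
- by rewrite -rev_rcons -lp -lastI rev_uniq.
Qed.

(* Going to z along p and back along q is a cycle. *)
Lemma tree_no_fork x z p q :
    path (adj E) x (rcons p z) -> path (adj E) x (rcons q z) ->
  uniq (x :: rcons p z ++ q) -> p = [::] /\ q = [::].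
Proof.
move=> pp pq upq; have [_ _ _ acyc] := treeE.
suff: size (x :: rcons p z ++ rev q) <= 2.
  rewrite /= size_cat size_rcons size_rev addSn !ltnS leqn0 addn_eq0.
  by case/andP=> /eqP/size0nil-> /eqP/size0nil->.
apply: acyc; rewrite /ucycle /=; apply/andP; split; last first.
  move: upq => /=; rewrite !mem_cat !mem_rev !cat_uniq rev_uniq.
  by rewrite (eq_has_r (mem_rev q)).
rewrite rcons_cat cat_path pp /= last_rcons -rev_cons.
by rewrite -path_adj_rev last_rcons belast_rcons in pq.
Qed.

(** When the first steps agree, induction applies; otherwise the two paths part at [x] and meet
    again, which [tree_no_fork] excludes. *)
Lemma simple_path_unique x y p q :
  simple_path E x y p -> simple_path E x y q -> p = q.
Proof.
elim: p x q => [|a p IHp] x [|b q] //.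
- move=> /and3P[_ /eqP /= <- _] /and3P[_ /eqP/= lq /andP[]].
  by rewrite -{1}lq mem_last.
- move=> /and3P[_ /eqP/= lp /andP[+ _]] /and3P[_ /eqP /= lq _].
  by rewrite lq -{1}lp mem_last.
move=> sp sq; have [eab|nab] := eqVneq a b.
  rewrite -eab in sq *; congr (_ :: _); apply: (IHp a).
    by case/and3P: sp => /= /andP[_ pp] lp /andP[_ up]; apply/and3P.
  by case/and3P: sq => /= /andP[_ pp] lp /andP[_ up]; apply/and3P.
case/and3P: sp => pp /eqP lp up; case/and3P: sq => pq /eqP lq uq.
have hpq: has (mem (b :: q)) (a :: p).
  apply/hasP; exists y; first by rewrite -lp; exact: (mem_last a p).
  by rewrite -lq; exact: (mem_last b q).
have [c pE] : exists c, c = a :: p by exists (a :: p).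
have [d qE] : exists c, c = b :: q by exists (b :: q).
rewrite -pE -qE in pp up pq uq hpq.
(* Cut the first path at its first vertex [z] on the second one; the part [p1] before [z] avoids
   that path. *)
case/split_find: hpq pE pp up => z p1 p2 zd p1d pE pp up.
have {}zd: z \in d by [].
case/splitPr: zd qE pq uq p1d => q1 q2 qE pq uq p1d.
have [|||p10 q10] := @tree_no_fork x z p1 q1.
- by move: pp; rewrite cat_path => /andP[].
- by move: pq; rewrite -cat_rcons cat_path => /andP[].
- move: up uq p1d; rewrite -cat_rcons /= !cat_uniq !mem_cat !negb_or.
  case/and3P=> /andP[-> _] up1 _ /and3P[/andP[xq1 _] uq1 _] p1d.
  rewrite up1.
  move: xq1 uq1; rewrite rcons_uniq mem_rcons inE negb_or => /andP[_ ->] /andP[zq1 ->].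
  rewrite /= andbT; apply/hasPn => t tq1; rewrite /= mem_rcons inE negb_or.
  rewrite (memPn zq1) //=; apply: contra p1d => tp1.
  by apply/hasP; exists t; rewrite //= mem_cat mem_rcons inE tq1 orbT.
(* Both paths step directly from [x] to [z], so [a = b]. *)
by move: pE qE nab; rewrite p10 q10 => -[-> _] [-> _]; rewrite eqxx.
Qed.

Lemma tpath_simple x y p : simple_path E x y p -> tpath E x y = x :: p.
Proof.
move=> sp; rewrite /tpath; case: pickP => [q sq|nop].
  by rewrite (simple_path_unique sq sp).
have sizep : size p <= #|V|.
  case/and3P: sp => _ _ /card_uniqP e.
  by apply/ltnW; rewrite -/(size (x :: p)) -e max_card.
by have := nop (Bseq sizep); rewrite sp.
Qed.

Lemma walk_tpath x p :
  path (adj E) x p ->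
  exists2 q, simple_path E x (last x p) q & {subset x :: q <= x :: p}.
Proof.
case/shortenP=> q pq uq sub; exists q; first by apply/and3P.
by move=> t; rewrite !inE => /orP[->//|/sub->]; rewrite orbT.
Qed.

Lemma simple_path_exists x y : exists p, simple_path E x y p.
Proof.
have [_ _ conn _] := treeE; have /connectP[p pp ->] := conn x y.
by have [q sq _] := walk_tpath pp; exists q.
Qed.

(** * Tree paths as vertex sets: the betweenness relation *)

Definition seg x y : {set V} := locked [set z in tpath E x y].

Lemma mem_seg x y z : (z \in seg x y) = (z \in tpath E x y).
Proof. by rewrite /seg -lock inE. Qed.

Lemma segE x y p : simple_path E x y p -> seg x y =i x :: p.
Proof. by move=> sp z; rewrite mem_seg (tpath_simple sp). Qed.

Lemma walk_seg x p : path (adj E) x p -> {subset seg x (last x p) <= x :: p}.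
Proof. by case/walk_tpath=> q sq sub z; rewrite (segE sq) => /sub. Qed.

Lemma segC x y : seg x y = seg y x.
Proof.
have [p sp] := simple_path_exists x y; apply/setP=> z.
rewrite (segE sp) (segE (simple_path_rev sp)).
by case/and3P: sp => _ /eqP lp _; rewrite lastI lp mem_rcons !inE mem_rev.
Qed.

Lemma segxx x : seg x x = [set x].
Proof.
by apply/setP=> z; rewrite (@segE _ _ [::]) ?inE // /simple_path /= eqxx.
Qed.

Lemma seg_l x y : x \in seg x y.
Proof. by have [p sp] := simple_path_exists x y; rewrite (segE sp) mem_head. Qed.

Lemma seg_r x y : y \in seg x y.
Proof. by rewrite segC seg_l. Qed.

Lemma simple_path_cat x z y p q :
  simple_path E x y (p ++ q) -> last x p = z ->
  simple_path E x z p /\ simple_path E z y q.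
Proof.
case/and3P; rewrite cat_path last_cat -cat_cons cat_uniq => /andP[pp pq] lq.
case/and3P=> up npq uq lp; rewrite lp in pq lq; split; apply/and3P; split=> //.
  exact/eqP.
rewrite /= uq andbT; apply: contra npq => zq; apply/hasP; exists z => //.
by rewrite -lp /= mem_last.
Qed.

Lemma seg_split x y z : z \in seg x y ->
  exists p q, [/\ simple_path E x y (p ++ q), simple_path E x z p
    & simple_path E z y q].
Proof.
have [p sp] := simple_path_exists x y; rewrite (segE sp) => zp.
case/splitPl: zp sp => p1 p2 lp sp; exists p1, p2.
by have [] := simple_path_cat sp lp.
Qed.

Lemma seg_sub x y z : z \in seg x y -> seg x z \subset seg x y.
Proof.
case/seg_split=> p [q [sp sp1 _]]; apply/subsetP=> w.
by rewrite (segE sp) (segE sp1) -cat_cons mem_cat => ->.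
Qed.

(** The path from [x] to [y] meets the four vertices in the order [x], [w], [z], [y]. *)
Lemma seg_mid x y z w : z \in seg x y -> w \in seg x z -> z \in seg w y.
Proof.
case/seg_split=> p [q [sp sp1 _]]; rewrite (segE sp1) => wp.
case/splitPl: wp sp sp1 => p1 p2 lp; rewrite -catA => sp sp1.
have [_ s1] := simple_path_cat sp lp; have [_ s2] := simple_path_cat sp1 lp.
rewrite (segE s1); case/and3P: s2 => _ /eqP <- _.
by rewrite -cat_cons mem_cat mem_last.
Qed.

Lemma seg_triangle x y w : seg x y \subset seg x w :|: seg w y.
Proof.
have [p sp] := simple_path_exists x w; have [q sq] := simple_path_exists w y.
apply/subsetP=> z; rewrite inE (segE sp) (segE sq).
case/and3P: sp => pp /eqP lp _; case/and3P: sq => pq /eqP lq _.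
have := @walk_seg x (p ++ q); rewrite cat_path pp lp last_cat lp lq => /(_ pq) sub.
move/sub; rewrite -cat_cons mem_cat => /orP[->//|zq].
by rewrite [z \in _ :: q]inE zq !orbT.
Qed.

(** Two simple paths that meet only in [m] concatenate to a simple path. *)
Lemma seg_join x y m :
  (forall w, w \in seg x m -> w \in seg m y -> w = m) -> m \in seg x y.
Proof.
have [p sp] := simple_path_exists x m; have [q sq] := simple_path_exists m y.
move=> disj; suff s: simple_path E x y (p ++ q).
  rewrite (segE s) -cat_cons mem_cat; case/and3P: sp => _ /eqP <- _.
  by rewrite mem_last.
have xm w : w \in x :: p -> w \in m :: q -> w = m.
  by rewrite -(segE sp) -(segE sq); apply: disj.
case/and3P: sp => pp /eqP lp up; case/and3P: sq => pq /eqP lq /= /andP[mq uq].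
apply/and3P; split; rewrite ?cat_path ?last_cat ?lp ?lq ?pp //.
rewrite -cat_cons cat_uniq up uq andbT; apply/hasPn=> w wq; apply/negP=> wp.
by move: mq; rewrite -(xm w) ?wq // inE wq orbT.
Qed.

Lemma seg_adj x y : adj E x y -> seg x y = [set x; y].
Proof.
move=> xy; apply/setP=> z; rewrite (@segE _ _ [:: y]) ?inE //.
by rewrite /simple_path /= xy eqxx inE (adj_neq xy).
Qed.

Lemma adj_seg x y : x != y -> seg x y \subset [set x; y] -> adj E x y.
Proof.
have [p sp] := simple_path_exists x y; have := segE sp.
case/and3P: sp => pp /eqP lp up sE nxy /subsetP sub.
case: p pp lp up sE => [|a [|b p]] /=.
- by move=> _ xy; rewrite xy eqxx in nxy.
- by rewrite andbT => pa <-.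
rewrite !inE !negb_or -!andbA => _ lp /and5P[xa xb xp ab /andP[ap _]] sE.
have: a \in seg x y by rewrite sE !inE eqxx orbT.
move/sub; rewrite !inE [a == x]eq_sym (negbTE xa) => /eqP ay.
by rewrite -ay in lp; have := mem_last b p; rewrite lp inE (negbTE ab) (negbTE ap).
Qed.

Lemma edge_card e : e \in E -> #|e| = 2.
Proof. by case: treeE => _ h _ _; apply: h. Qed.

Lemma edgeP e : reflect (exists x y, adj E x y /\ e = [set x; y]) (e \in E).
Proof.
apply: (iffP idP) => [eE|[x [y [/andP[_ xyE] ->]]] //].
have /eqP/cards2P[x [y [nxy exy]]] := edge_card eE.
by exists x, y; rewrite /adj nxy -exy.
Qed.

(** The point is that adjacent vertices of the path are consecutive on it: the stretch between them
    is a simple path, hence the edge alone by uniqueness. *)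
Lemma mem_tpath_edges x y e :
  (e \in tpath_edges E x y) = (e \in E) && (e \subset seg x y).
Proof.
have [p sp] := simple_path_exists x y.
have sE := segE sp; rewrite /tpath_edges (tpath_simple sp).
apply/idP/andP => [|[/edgeP[a [b [ab ->]]]]].
  have: {subset x :: p <= seg x y} by move=> z; rewrite sE.
  case/and3P: sp {sE} => + _ _; move: (seg x y) => s.
  elim: p x => [//|a p IHp] x /=.
  case/andP=> xa pp sub; rewrite inE => /orP[/eqP->|]; last first.
    by apply: IHp => // z zp; apply: sub; rewrite inE zp orbT.
  case/andP: xa => _ ->; split=> //; apply/subsetP=> z; rewrite !inE.
  by case/orP=> /eqP ->; apply: (sub); rewrite !inE eqxx ?orbT.
rewrite subUset !sub1set !sE => /andP[ap bp].
(* It suffices to treat the end [b'] that comes after [a']; the other order follows by exchanging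
   the two ends. *)
suff main a' b' p1 p2 : adj E a' b' -> p = p1 ++ p2 -> last x p1 = a' ->
    b' \in p2 -> [set a'; b'] \in pairmap (fun u v => [set u; v]) x p.
  case/splitPl: {2}p / ap (erefl p) => p1 p2 lp1 pE.
  move: (bp); rewrite {1}pE -cat_cons mem_cat => /orP[]; last exact: main ab pE lp1.
  move=> bp1; case/splitPl: {1}p1 / bp1 (erefl p1) => q1 q2 lq1 p1E.
  rewrite setUC; apply: (@main _ _ q1 (q2 ++ p2)); rewrite // 1?adj_sym //.
    by rewrite pE -p1E catA.
  have : a \in b :: q2 by rewrite -lp1 -p1E last_cat lq1 mem_last.
  by rewrite inE (negbTE (adj_neq ab)) mem_cat => /= ->.
move=> ab' pE lp1 /splitPr b'p2; case: b'p2 pE => q1 q2 pE.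
move: (sp); rewrite pE => sp'; have [_ s2] := simple_path_cat sp' lp1.
rewrite -cat_rcons in s2; have [|s3 _] := @simple_path_cat a' b' _ _ _ s2.
  by rewrite last_rcons.
have: rcons q1 b' = [:: b'].
  apply: simple_path_unique s3 _.
  by rewrite /simple_path /= ab' eqxx inE (adj_neq ab').
case: q1 {s2 sp' s3 pE} => [|c [|c' q1]] // _.
by rewrite pairmap_cat /= lp1 mem_cat inE eqxx orbT.
Qed.

Lemma seg_antisym x y z : y \in seg x z -> z \in seg x y -> y = z.
Proof.
by move=> yz zy; have := seg_mid zy yz; rewrite segxx inE => /eqP.
Qed.

(** Take the vertex [m] of the path from [x] to [y] closest to [z]. The path from [z] to [m] meets
    the former path only in [m], so it can be joined with either half. *)
Lemma seg_median x y z :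
  exists m, [/\ m \in seg x y, m \in seg y z & m \in seg x z].
Proof.
case: (arg_minnP (fun m => #|seg z m|) (seg_l x y)) => m mxy mmin.
have closest w : w \in seg z m -> w \in seg x y -> w = m.
  move=> wzm wxy; apply: contraTeq (mmin w wxy) => nwm; rewrite -ltnNge.
  apply: proper_card; rewrite properE seg_sub //; apply: contra nwm => sub.
  by apply/eqP/(seg_antisym wzm)/(subsetP sub); rewrite seg_r.
exists m; split=> //; [rewrite segC | rewrite segC]; apply: seg_join => w wz.
  move=> wm; apply: closest => //; rewrite segC.
  by move: mxy; rewrite segC => /seg_sub/subsetP->//; rewrite segC.
by move=> wm; apply: closest => //; apply: (subsetP (seg_sub mxy)); rewrite segC.
Qed.

Lemma seg_subr x y z : z \in seg x y -> seg z y \subset seg x y.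
Proof. by rewrite segC (segC z) => /seg_sub. Qed.

Lemma card_seg_lt x y z : z \in seg x y -> z != y -> #|seg x z| < #|seg x y|.
Proof.
move=> zxy; apply: contraR; rewrite -leqNgt => le.
apply/eqP/(seg_antisym zxy); have /eqP-> : seg x z == seg x y.
  by rewrite eqEcard seg_sub.
exact: seg_r.
Qed.

(** The two paths overlap in a stretch from [y] to [z] of positive length and glue to one path. For
    [y = z] the hypotheses would be void. *)
Lemma seg_trans x y z t :
  y \in seg x z -> z \in seg y t -> y != z -> z \in seg x t.
Proof.
move=> yxz zyt nyz; have := subsetP (seg_triangle x z t) _ yxz.
rewrite inE => /orP[yxt|ytz]; first by apply: (subsetP (seg_subr yxt)).
by move: nyz; rewrite (@seg_antisym t y z) ?eqxx // segC.
Qed.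

Lemma seg_opposite x y z u :
  z \in seg x y -> u \in seg z x -> u \in seg z y -> u = z.
Proof.
rewrite (segC z x) => zxy /(seg_mid zxy); rewrite segC (segC z) => zu uz.
by apply: seg_antisym uz zu.
Qed.

(** Serves to push [x] and [y] away from [z], out to terminals lying behind them. *)
Lemma seg_extend x y z s t :
  z \in seg x y -> x \in seg z s -> y \in seg z t -> x != z -> y != z ->
  z \in seg s t.
Proof.
rewrite (segC _ s) (segC _ t) => zxy xs yt nx ny.
have {zxy}zsy := seg_trans xs zxy nx; rewrite segC in zsy.
by rewrite segC; apply: seg_trans yt zsy ny.
Qed.

(** * Median-closed sets and their skeletons *)

Definition median_closed (K : {set V}) := forall x y t m,
  x \in K -> y \in K -> t \in K ->
  m \in seg x y -> m \in seg y t -> m \in seg x t -> m \in K.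

(* The terminals A together with the branching vertices of the union of the paths
   between them. *)
Definition junctions (A : {set V}) : {set V} :=
  [set m | [exists x in A, exists y in A, exists t in A,
    [&& m \in seg x y, m \in seg y t & m \in seg x t]]].

Lemma junctionsP (A : {set V}) m :
  reflect (exists x y t, [/\ x \in A, y \in A & t \in A] /\
             [/\ m \in seg x y, m \in seg y t & m \in seg x t])
          (m \in junctions A).
Proof.
rewrite inE; apply: (iffP exists_inP) => [[x xA]|[x [y [t [[xA yA tA] mx]]]]].
  case/exists_inP=> y yA /exists_inP[t tA /and3P[]].
  by exists x, y, t.
exists x => //; apply/exists_inP; exists y => //; apply/exists_inP; exists t => //.
exact/and3P.
Qed.

(** The vertex set of the subtree spanned by [A], that is of [path_union E A]. *)
Definition hull (A : {set V}) : {set V} :=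
  \bigcup_(x in A) \bigcup_(y in A) seg x y.

Lemma hullP (A : {set V}) z :
  reflect (exists x y, [/\ x \in A, y \in A & z \in seg x y]) (z \in hull A).
Proof.
apply: (iffP bigcupP) => [[x xA /bigcupP[y yA zxy]]|[x [y [xA yA zxy]]]].
  by exists x, y.
by exists x => //; apply/bigcupP; exists y.
Qed.

Lemma sub_junctions (A : {set V}) : A \subset junctions A.
Proof.
apply/subsetP=> x xA; apply/junctionsP; exists x, x, x; split=> //.
by rewrite seg_l.
Qed.

Lemma junctions_sub_hull (A : {set V}) : junctions A \subset hull A.
Proof.
apply/subsetP=> m /junctionsP[x [y [_ [[xA yA _] [mxy _ _]]]]].
by apply/hullP; exists x, y.
Qed.

Lemma junctions_mono (A B : {set V}) :
  A \subset B -> junctions A \subset junctions B.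
Proof.
move/subsetP=> AB; apply/subsetP=> m /junctionsP[x [y [t [[xA yA tA] mM]]]].
by apply/junctionsP; exists x, y, t; split=> //; split; apply: AB.
Qed.

Lemma junctions_min (A K : {set V}) :
  A \subset K -> median_closed K -> junctions A \subset K.
Proof.
move/subsetP=> AK mK; apply/subsetP=> m /junctionsP[x [y [t [[xA yA tA] []]]]].
by apply: mK; apply: AK.
Qed.

(** The path from [x] to [y] is covered by the paths from [v] to its ends, so seen from [v] some
    terminal lies at or behind [z]. *)
Lemma hull_behind (A : {set V}) z v :
  z \in hull A -> exists2 s, s \in A & z \in seg v s.
Proof.
case/hullP=> x [y [xA yA /(subsetP (seg_triangle x y v))]].
by rewrite inE segC => /orP[]; [exists x | exists y].
Qed.

(** Each of the three points is replaced by a terminal behind it as seen from [m]. *)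
Lemma mem_junctions3 (A : {set V}) m x y t :
    x \in hull A -> y \in hull A -> t \in hull A ->
    x != m -> y != m -> t != m ->
    m \in seg x y -> m \in seg y t -> m \in seg x t ->
  m \in junctions A.
Proof.
move=> /(@hull_behind _ _ m)[x' x'A xx'] /(@hull_behind _ _ m)[y' y'A yy'].
move=> /(@hull_behind _ _ m)[t' t'A tt'] nx ny nt mxy myt mxt.
by apply/junctionsP; exists x', y', t'; split=> //; split;
  [apply: seg_extend mxy _ _ _ _ | apply: seg_extend myt _ _ _ _
  | apply: seg_extend mxt _ _ _ _].
Qed.

(** One round of medians suffices: junctions lie in the hull, so [mem_junctions3] turns a median of
    junctions into a median of terminals. *)
Lemma median_closed_junctions (A : {set V}) : median_closed (junctions A).
Proof.
move=> x y t m xK yK tK mxy myt mxt.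
have [<-//|nx] := eqVneq x m; have [<-//|ny] := eqVneq y m.
have [<-//|nt] := eqVneq t m; have /subsetP sub := junctions_sub_hull A.
by apply: mem_junctions3 mxy myt mxt => //; apply: sub.
Qed.

Lemma median_closed_hull (A : {set V}) : median_closed (hull A).
Proof.
move=> x y t m xK yK _ mxy _ _.
have [<-//|nx] := eqVneq x m; have [<-//|ny] := eqVneq y m.
have [x' x'A xx'] := hull_behind m xK; have [y' y'A yy'] := hull_behind m yK.
by apply/hullP; exists x', y'; split=> //; apply: seg_extend mxy _ _ _ _.
Qed.

(** Quantifying over all pairs from [e] avoids ordering its ends; pairs with [x = y] impose nothing,
    the path being a single vertex of [e]. *)
Definition skel_edges (K : {set V}) : {set {set V}} :=
  [set e : {set V} | [&& #|e| == 2, e \subset K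
    & [forall x in e, forall y in e, K :&: seg x y \subset e]]].

(* For K closed under medians: the union of the paths between the points of K,
   with all vertices outside K, which have degree two there, spliced out. *)
Definition skel (K : {set V}) : ugraph V := UGraph K (skel_edges K).

Lemma skel_edges2 (K : {set V}) x y :
  ([set x; y] \in skel_edges K) =
  [&& x != y, x \in K, y \in K & K :&: seg x y \subset [set x; y]].
Proof.
rewrite inE cards2 subUset !sub1set; case: (eqVneq x y) => //= nxy.
case xK: (x \in K) => //=; case yK: (y \in K) => //=.
apply/forall_inP/idP=> [/(_ x (set21 x y))/forall_inP|sub u].
  by apply; exact: set22.
have loop z : K :&: seg z z \subset [set z].
  by rewrite segxx subIset // subxx orbT.
rewrite !inE => /orP[]/eqP->; apply/forall_inP=> w; rewrite !inE => /orP[]/eqP->.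
- by apply: subset_trans (loop x) _; rewrite subsetUl.
- by [].
- by rewrite segC.
- by apply: subset_trans (loop y) _; rewrite subsetUr.
Qed.

Lemma skel_edges2P (K : {set V}) x y :
  reflect [/\ x != y, x \in K, y \in K & K :&: seg x y \subset [set x; y]]
          ([set x; y] \in skel_edges K).
Proof. by rewrite skel_edges2; apply: and4P. Qed.

Lemma skel_edge_ends (K e : {set V}) : e \in skel_edges K ->
  exists x y, e = [set x; y].
Proof. by rewrite inE => /and3P[/cards2P[x [y [_ ->]]] _ _]; exists x, y. Qed.

Definition nbrs (K : {set V}) v : {set V} :=
  [set u | [set v; u] \in skel_edges K].

Lemma nbrsP (K : {set V}) v u :
  reflect [/\ u != v, v \in K, u \in K
             & forall z, z \in K -> z \in seg v u -> z = v \/ z = u]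
          (u \in nbrs K v).
Proof.
rewrite inE skel_edges2 eq_sym.
apply: (iffP and4P) => [[-> -> -> /subsetP sub]|[-> -> -> sub]]; split=> //.
  move=> z zK zs; have := sub z; rewrite !inE zK zs => /(_ isT)/orP[]/eqP; tauto.
by apply/subsetP=> z; rewrite !inE => /andP[zK /(sub z zK)[]->]; rewrite eqxx ?orbT.
Qed.

Lemma uincident_skel (K : {set V}) v :
  uincident (skel K) v = [set [set v; u] | u in nbrs K v].
Proof.
apply/setP=> e; apply/idP/imsetP => [|[u uN ->]]; last first.
  by rewrite inE /= !inE eqxx andbT; rewrite inE in uN; rewrite inE in uN.
rewrite inE /= => /andP[eK ve]; have [x [y exy]] := skel_edge_ends eK.
move: ve eK; rewrite exy !inE => /orP[]/eqP->.
  by exists y; rewrite // inE skel_edges2 -skel_edges2 inE.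
by rewrite setUC; exists x; rewrite // inE skel_edges2 -skel_edges2 inE.
Qed.

Lemma card_uincident_skel (K : {set V}) v :
  #|uincident (skel K) v| = #|nbrs K v|.
Proof.
rewrite uincident_skel card_in_imset // => a b aN bN /setP/(_ a).
rewrite !inE eqxx orbT; case/nbrsP: aN => /negbTE -> _ _ _ /=.
by move/esym/eqP.
Qed.

(** Take the vertex of [K] closest to [v], other than [v], on the path to [x]. *)
Lemma nbr_toward (K : {set V}) v x :
  v \in K -> x \in K -> x != v -> exists2 u, u \in nbrs K v & u \in seg v x.
Proof.
move=> vK xK nxv.
have Px : [&& x \in K, x != v & x \in seg v x] by rewrite xK nxv seg_r.
case: (@arg_minnP _ x (fun u => [&& u \in K, u != v & u \in seg v x])
   (fun u => #|seg v u|) Px) => u /and3P[uK nuv us] umin.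
exists u => //; apply/nbrsP; split=> // z zK zs.
have [->|nzv] := eqVneq z v; [by left | right].
apply: contraTeq (umin z _) => [nzu|]; first by rewrite -ltnNge card_seg_lt.
by rewrite zK nzv (subsetP (seg_sub us)).
Qed.

(** The median of [v], [a], [b] is in [K] and lies on the paths from [v] to both neighbours; were it
    not [v], it would equal both [a] and [b]. *)
Lemma nbrs_separated (K : {set V}) v a b :
  median_closed K -> a \in nbrs K v -> b \in nbrs K v -> a != b -> v \in seg a b.
Proof.
move=> mK /nbrsP[nav vK aK an] /nbrsP[nbv _ bK bn] nab.
have [m [mva mab mvb]] := seg_median v a b.
have mK' := mK v a b m vK aK bK mva mab mvb.
have [<-//|ma] := an m mK' mva; have [<-//|mb] := bn m mK' mvb.
by rewrite -ma mb eqxx in nab.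
Qed.

(** The paths from [v] to [x] and to [y] meet only in [v], so the neighbours of [v] in these
    directions differ. *)
Lemma nbrs_toward2 (K : {set V}) v x y :
    v \in K -> x \in K -> y \in K -> x != v -> y != v -> v \in seg x y ->
  1 < #|nbrs K v|.
Proof.
move=> vK xK yK nx ny vxy; apply/card_gt1P.
have [a aN ax] := nbr_toward vK xK nx; have [b bN by_] := nbr_toward vK yK ny.
exists a, b; split=> //; case/nbrsP: aN => nav _ _ _.
by apply: contraNneq nav => eab; rewrite -eab in by_; rewrite (seg_opposite vxy ax by_).
Qed.

Lemma nbrs_toward3 (K : {set V}) v x y t :
    v \in K -> x \in K -> y \in K -> t \in K -> x != v -> y != v -> t != v ->
    v \in seg x y -> v \in seg y t -> v \in seg x t ->
  2 < #|nbrs K v|.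
Proof.
move=> vK xK yK tK nx ny nt vxy vyt vxt; apply/card_gt2P.
have [a aN ax] := nbr_toward vK xK nx; have [b bN by_] := nbr_toward vK yK ny.
have [c cN ct] := nbr_toward vK tK nt.
exists a, b, c; split=> //.
have neq a1 a2 x1 x2 : a1 \in nbrs K v -> a1 \in seg v x1 -> a2 \in seg v x2 ->
    v \in seg x1 x2 -> a1 != a2.
  case/nbrsP=> na1v _ _ _ a1x1 a2x2 vx12; apply: contraNneq na1v => ea.
  by rewrite -ea in a2x2; rewrite (seg_opposite vx12 a1x1 a2x2).
split; [exact: neq aN ax by_ vxy | exact: neq bN by_ ct vyt |].
by rewrite eq_sym; exact: neq aN ax ct vxt.
Qed.

(** If [v] were the median of three other vertices of [K], it would have three neighbours. *)
Lemma median_closed_del (K : {set V}) v :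
  median_closed K -> v \in K -> #|nbrs K v| <= 2 -> median_closed (K :\ v).
Proof.
move=> mK vK; rewrite leqNgt => deg x y t m; rewrite !inE.
move=> /andP[nx xK] /andP[ny yK] /andP[nt tK] mxy myt mxt.
rewrite (mK x y t) // andbT; apply: contraNneq deg => mv; rewrite mv in mxy myt mxt.
exact: (@nbrs_toward3 _ _ x y t).
Qed.

Lemma in_uincident_skel (K : {set V}) v e :
  (e \in uincident (skel K) v) = (e \in skel_edges K) && (v \in e).
Proof. by rewrite /uincident /= in_set. Qed.

(** An edge of the smaller skeleton whose path avoids [v] was an edge before. If the path contains
    [v], then nothing else of [K] lies between the ends, which are thus neighbours of [v]. *)
Lemma skel_edges_del (K : {set V}) v e : median_closed K -> v \in K ->
  (e \in skel_edges (K :\ v)) <->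
  (e \in skel_edges K /\ v \notin e \/
   exists a b, [/\ a \in nbrs K v, b \in nbrs K v, a != b & e = [set a; b]]).
Proof.
move=> mK vK; split=> [eK'|].
  have [x [y exy]] := skel_edge_ends eK'; move: eK'; rewrite exy skel_edges2.
  rewrite 2!in_setD1 => /and4P[nxy /andP[nxv xK] /andP[nyv yK]] /subsetP sub.
  have [vxy|nvxy] := boolP (v \in seg x y); [right | left]; last first.
    rewrite skel_edges2 nxy xK yK !inE ![v == _]eq_sym negb_or nxv nyv; split=> //.
    apply/subsetP=> z; rewrite inE => /andP[zK zxy]; apply: sub.
    by rewrite in_setI in_setD1 zK zxy !andbT; apply: contraNneq nvxy => <-.
  have only u : u \in K -> u != v -> u \in seg x y -> u = x \/ u = y.
    move=> uK nuv uxy; have := sub u; rewrite !inE uK nuv uxy => /(_ isT).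
    by case/orP=> /eqP; [left | right].
  have [a aN ax] := nbr_toward vK xK nxv; have [b bN by_] := nbr_toward vK yK nyv.
  have [nav _ aK _] := nbrsP _ _ _ aN; have [nbv _ bK _] := nbrsP _ _ _ bN.
  have vyx : v \in seg y x by rewrite segC.
  (* The neighbour [a] lies between [x] and [y], so it is one of them; [y] is on the other side of
     [v]. *)
  have ea : a = x.
    have [|//|ay] := only a aK nav.
      by rewrite segC; apply: (subsetP (seg_subr vyx)).
    by case/eqP: nyv; rewrite -ay; apply: seg_opposite vxy ax _; rewrite ay seg_r.
  have eb : b = y.
    have [|bx|//] := only b bK nbv; first by apply: (subsetP (seg_subr vxy)).
    by case/eqP: nxv; rewrite -bx; apply: seg_opposite vyx by_ _; rewrite bx seg_r.
  by exists x, y; split=> //; rewrite -?ea // -eb.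
case=> [[eK nve]|[a [b [aN bN nab ->]]]].
  have [x [y exy]] := skel_edge_ends eK; move: eK nve; rewrite exy !skel_edges2.
  rewrite !inE negb_or ![v == _]eq_sym => /and4P[-> -> -> sub] /andP[-> ->] /=.
  by apply: subset_trans sub; apply: setSI; apply: subsetDl.
have vab := nbrs_separated mK aN bN nab.
have [nav _ aK an] := nbrsP _ _ _ aN; have [nbv _ bK bn] := nbrsP _ _ _ bN.
rewrite skel_edges2 nab !in_setD1 nav nbv aK bK /=; apply/subsetP=> z.
rewrite inE in_setD1 => /andP[/andP[nzv zK] /(subsetP (seg_triangle a b v))].
rewrite in_set2 inE (segC a v) => /orP[/(an z zK)|/(bn z zK)] [] /eqP.
- by rewrite (negbTE nzv).
- by move->.
- by rewrite (negbTE nzv).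
- by move->; rewrite orbT.
Qed.

(** With exactly two neighbours, the new edges of [skel_edges_del] reduce to the one edge created by
    splicing. *)
Lemma usplice_skel (K : {set V}) v :
    median_closed K -> v \in K -> #|nbrs K v| = 2 ->
  usplice (skel K) v = skel (K :\ v).
Proof.
move=> mK vK /eqP/cards2P[a [b [nab nE]]]; rewrite /usplice /skel /=.
congr UGraph; apply/setP=> e.
have incE : uincident (skel K) v = [set [set v; a]; [set v; b]].
  by rewrite uincident_skel nE imsetU1 imset_set1.
have [aN bN] : a \in nbrs K v /\ b \in nbrs K v by rewrite nE set21 set22.
have [nav _ _ _] := nbrsP _ _ _ aN; have [nbv _ _ _] := nbrsP _ _ _ bN.
have -> : cover (uincident (skel K) v) :\ v = [set a; b].
  rewrite incE /cover bigcup_setU !big_set1; apply/setP=> z; rewrite !inE.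
  have [->|] /= := eqVneq z v; last by [].
  by rewrite ![v == _]eq_sym (negbTE nav) (negbTE nbv).
rewrite in_setU1 in_setD in_uincident_skel; apply/orP/idP.
  case=> [/eqP->|/andP[nev eK]]; apply/(skel_edges_del _ mK vK).
    by right; exists a, b.
  by left; rewrite eK in nev.
case/(skel_edges_del _ mK vK)=> [[-> nve]|[a' [b' []]]].
  by right; rewrite (negbTE nve).
rewrite nE !in_set2 => /orP[]/eqP-> /orP[]/eqP->; rewrite ?eqxx // => _ ->.
  by left.
by left; rewrite setUC.
Qed.

Lemma skel_del_leaf (K : {set V}) v :
    median_closed K -> v \in K -> #|nbrs K v| <= 1 ->
  skel_edges (K :\ v) = skel_edges K :\: uincident (skel K) v.
Proof.
move=> mK vK deg; apply/setP=> e; rewrite in_setD in_uincident_skel.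
apply/idP/idP => [/(skel_edges_del _ mK vK)[[-> ->] //|]|/andP[nev eK]].
  case=> a [b [aN bN nab _]]; move: deg; rewrite leqNgt => /negP[].
  by apply/card_gt1P; exists a, b.
by apply/(skel_edges_del _ mK vK); left; rewrite eK in nev.
Qed.

(** * Degrees of junctions and the splicing of the path union *)

Lemma mem_junctions_degree (A K : {set V}) v :
    median_closed K -> K \subset hull A -> 2 < #|nbrs K v| ->
  v \in junctions A.
Proof.
move=> mK /subsetP sub /card_gt2P[a [b [c [[aN bN cN] [nab nbc nca]]]]].
have sep := nbrs_separated mK.
have [nav _ /sub aK _] := nbrsP _ _ _ aN; have [nbv _ /sub bK _] := nbrsP _ _ _ bN.
have [ncv _ /sub cK _] := nbrsP _ _ _ cN.
apply: (@mem_junctions3 _ _ a b c) => //; apply: sep => //.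
by rewrite eq_sym.
Qed.

Lemma junction_degree (A K : {set V}) v :
  A \subset K -> v \in K -> v \notin A -> v \in junctions A -> 2 < #|nbrs K v|.
Proof.
move=> /subsetP AK vK vA /junctionsP[x [y [t [[xA yA tA] [vxy vyt vxt]]]]].
apply: (@nbrs_toward3 _ _ x y t) => //; try exact: AK; try exact: vK;
  by apply: contraNneq vA => <-.
Qed.

Lemma hull_degree (A K : {set V}) v :
  A \subset K -> v \in K -> v \notin A -> v \in hull A -> 1 < #|nbrs K v|.
Proof.
move=> /subsetP AK vK vA /hullP[x [y [xA yA vxy]]].
apply: (@nbrs_toward2 _ _ x y) => //; try exact: AK; try exact: vK;
  by apply: contraNneq vA => <-.
Qed.

(** Induction on the size of [K]: any splice deletes a vertex outside [A] and preserves the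
    hypotheses. At the end a vertex of [K] outside [A] has at least two neighbours, being in the
    hull, and not exactly two; with three it is a median. *)
Lemma splices_out_skel (A K : {set V}) :
    median_closed K -> A \subset K -> K \subset hull A ->
  splices_out A (skel K) (skel (junctions A)).
Proof.
have [n] := ubnP #|K|; elim: n K => [//|n IHn] K ltn mK AK Kh.
case: (pickP (spliceable A (skel K))) => [v spl|nospl].
  have := spl; rewrite /spliceable card_uincident_skel /= => /and3P[vK vA /eqP deg].
  apply: SpliceStep spl _; rewrite usplice_skel //; apply: IHn.
  - by rewrite (cardsD1 v) vK in ltn.
  - by apply: median_closed_del => //; rewrite deg.
  - by rewrite subsetD1 AK.
  - by apply: subset_trans Kh; apply: subsetDl.
have -> : junctions A = K; last by apply: SpliceDone => v; rewrite nospl.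
apply/eqP; rewrite eqEsubset junctions_min //=; apply/subsetP=> v vK.
have [vA|vA] := boolP (v \in A); first exact: (subsetP (sub_junctions A)).
apply: (mem_junctions_degree mK Kh); rewrite ltn_neqAle.
rewrite (hull_degree AK vK vA) ?(subsetP Kh) // andbT eq_sym.
by have := nospl v; rewrite /spliceable card_uincident_skel /= vK vA => /negbT.
Qed.

Lemma hull_convex (A : {set V}) a b :
  a \in hull A -> b \in hull A -> seg a b \subset hull A.
Proof.
move=> aA bA; apply/subsetP=> z zab.
have [<-//|nxz] := eqVneq a z; have [<-//|nyz] := eqVneq b z.
have [s sA as_] := hull_behind z aA; have [t tA bt] := hull_behind z bA.
by apply/hullP; exists s, t; split=> //; apply: seg_extend zab _ _ _ _.
Qed.

Lemma sub_hull (A : {set V}) : A \subset hull A.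
Proof. exact: subset_trans (sub_junctions A) (junctions_sub_hull A). Qed.

(** The hull is convex, so two of its vertices with no other hull vertex between them are adjacent
    in the tree. *)
Lemma path_union_skel (A : {set V}) : path_union E A = skel (hull A).
Proof.
rewrite /path_union /skel; congr UGraph.
  apply: eq_bigr => x _; apply: eq_bigr => y _.
  by apply/setP=> z; rewrite mem_seg inE.
apply/setP=> e; apply/bigcupP/idP => [[x xA /bigcupP[y yA]]|eH].
  rewrite inE mem_tpath_edges => /andP[/edgeP[a [b [ab ->]]]].
  rewrite subUset !sub1set => /andP[axy bxy].
  rewrite skel_edges2 (adj_neq ab) (seg_adj ab) subsetIr andbT /=.
  by apply/andP; split; apply/hullP; exists x, y.
have [a [b eab]] := skel_edge_ends eH; move: eH; rewrite eab skel_edges2.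
case/and4P=> nab aH bH; rewrite (setIidPr (hull_convex aH bH)) => /(adj_seg nab) ab.
(* Prolonging the edge at both ends to terminals [s] and [t] gives a path between terminals that
   runs through it. *)
have [s sA bs] := hull_behind a bH; have [t tA at_] := hull_behind b aH.
exists s => //; apply/bigcupP; exists t => //.
have asb : b \in seg s a by rewrite segC.
have atb : a \in seg t b by rewrite segC.
have nba : b != a by rewrite eq_sym.
case/andP: (ab) => _ abE; rewrite inE mem_tpath_edges abE subUset !sub1set.
by rewrite (seg_trans asb at_ nba) segC (seg_trans atb bs nab).
Qed.

(** * Weighted skeletons *)

Section Weights.

Variables (d : Order.disp_t) (W : orderType d) (w : {set V} -> W).

(** Characterizes [heaviest] as an attained upper bound, free of the order in which [enum] lists the
    two ends. *)
Lemma heaviestP x y : x != y ->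
  (forall e, e \in E -> e \subset seg x y -> (w e <= heaviest E w [set x; y])%O)
  /\ exists e, [/\ e \in E, e \subset seg x y & heaviest E w [set x; y] = w e].
Proof.
move=> nxy; rewrite /heaviest.
have: size (enum [set x; y]) = 2 by rewrite -cardE cards2 nxy.
have := mem_enum [set x; y]; case: (enum _) (enum_uniq [set x; y]) => [|a [|b []]] //.
rewrite /= inE andbT => nab abE _.
have -> : seg x y = seg a b.
  have := abE a; have := abE b; rewrite !inE !eqxx orbT.
  case/esym/orP=> /eqP eb /esym/orP[]/eqP ea; rewrite ea eb ?eqxx // in nab *.
  by rewrite segC.
have [_ [ub hin]] :=
  bigmax_seq w (w (head [set x; y] (tpath_edges E a b))) (tpath_edges E a b).
split=> [e eE es|]; first by apply: ub; rewrite mem_tpath_edges eE.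
(* The initial value of the maximum must be the weight of a path edge and not of the default of
   [head]; the path is nonempty because its ends differ. *)
suff ne : head [set x; y] (tpath_edges E a b) \in tpath_edges E a b.
  have: \big[Order.max/w (head [set x; y] (tpath_edges E a b))]_(f <- tpath_edges E a b)
      w f \in map w (tpath_edges E a b).
    by move: hin; rewrite inE => /orP[/eqP->|//]; apply: map_f.
  by case/mapP=> e; rewrite mem_tpath_edges => /andP[eE es] ->; exists e.
rewrite /tpath_edges; have [p' sp] := simple_path_exists a b.
rewrite (tpath_simple sp); case: p' sp => [|c p'] /=; last by rewrite mem_head.
by case/and3P=> _ /=; rewrite (negbTE nab).
Qed.

Lemma edge_sub_seg_split a b v e :
    v \in seg a b -> e \in E ->
  (e \subset seg a b) = (e \subset seg a v) || (e \subset seg v b).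
Proof.
move=> vab eE; apply/idP/orP=> [|[]]; last 2 first.
- by move/subset_trans; apply; apply: seg_sub.
- by move/subset_trans; apply; apply: seg_subr.
have [x [y [xy ->]]] := edgeP _ eE; rewrite !subUset !sub1set => /andP[xab yab].
have := subsetP (seg_triangle a b v) _ xab; have := subsetP (seg_triangle a b v) _ yab.
have [->|nxv] := eqVneq x v.
  by rewrite seg_l seg_r !inE => /orP[]->; [left | right].
have [->|nyv] := eqVneq y v.
  by rewrite seg_l seg_r !inE !andbT => _ /orP[]->; [left | right].
(* An edge with ends on both sides of [v] has [v] between its ends, so one of them is [v]. *)
have cross x' y' : x' \in seg a v -> y' \in seg v b -> adj E x' y' -> x' != v -> y' == v.
  move=> xa yb xy' nx'; have := seg_adj xy' => s.
  have : v \in seg x' y'.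
    have := seg_mid vab xa; rewrite segC => vbx.
    by rewrite segC; apply: seg_mid vbx _; rewrite segC.
  by rewrite s !inE [v == _]eq_sym (negbTE nx') eq_sym.
rewrite !inE => /orP[ya|yb] /orP[xa|xb].
- by left; rewrite xa.
- by move: xy; rewrite adj_sym => /(cross _ _ ya xb)/(_ nyv); rewrite (negbTE nxv).
- by move: xy => /(cross _ _ xa yb)/(_ nxv); rewrite (negbTE nyv).
- by right; rewrite xb.
Qed.

(** The edges of the path are those of its two halves; hence the larger weight taken when splicing
    out [v] is the right label. *)
Lemma heaviest_cat a b v : v \in seg a b -> a != v -> b != v ->
  heaviest E w [set a; b] =
  Order.max (heaviest E w [set v; a]) (heaviest E w [set v; b]).
Proof.
move=> vab nav nbv; have nab : a != b.
  by apply: contraNneq nav => eab; rewrite -eab segxx inE in vab; rewrite eq_sym.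
have [ub [e [eE es he]]] := heaviestP nab.
have nva : v != a by rewrite eq_sym.
have nvb : v != b by rewrite eq_sym.
have [uba [f [fE fs hf]]] := heaviestP nva; rewrite (segC v) in uba fs.
have [ubb [g [gE gs hg]]] := heaviestP nvb.
apply/Order.POrderTheory.le_anti/andP; split.
  rewrite Order.TotalTheory.le_max he; apply/orP.
  by move: es; rewrite (edge_sub_seg_split vab eE) => /orP[];
    [left; apply: uba | right; apply: ubb].
rewrite Order.TotalTheory.ge_max hf hg !ub //.
  by rewrite (edge_sub_seg_split vab gE) gs orbT.
by rewrite (edge_sub_seg_split vab fE) fs.
Qed.

(** * Labelled graphs and their incident edges *)

Local Notation lab := (label E w).

Lemma mem_weighted (D : {set {set V}}) e h :
  ((e, h) \in [fset (f, heaviest E w f) | f in D]%fset) =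
  (e \in D) && (h == heaviest E w e).
Proof.
apply/imfsetP/andP => [[f /= fD [-> ->]]|[eD /eqP->]]; first by rewrite eqxx.
by exists e.
Qed.

Lemma eq_label X F (U : ugraph V) :
    X = uverts U ->
    (forall e h, ((e, h) \in F) = (e \in uedges U) && (h == heaviest E w e)) ->
  WGraph X F = lab U.
Proof.
by move=> -> FE; congr WGraph; apply/fsetP=> -[e h]; rewrite FE -mem_weighted.
Qed.

Lemma mem_incident_label (U : ugraph V) v e h :
  ((e, h) \in incident (lab U) v) = (e \in uincident U v) && (h == heaviest E w e).
Proof.
rewrite /incident !inE /= mem_weighted.
by rewrite andbAC.
Qed.

Lemma incident_label (U : ugraph V) v :
  incident (lab U) v = [fset (e, heaviest E w e) | e in uincident U v]%fset.
Proof.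
apply/fsetP=> -[e h]; rewrite mem_incident_label.
apply/andP/imfsetP => [[eU /eqP->]|[f /= fU [-> ->]]]; first by exists e.
by rewrite eqxx.
Qed.

Lemma size_incident_label (U : ugraph V) v :
  size (enum_fset (incident (lab U) v)) = #|uincident U v|.
Proof.
rewrite incident_label -[LHS]/(#|` _|)%fset card_in_imfset /=; last by move=> e f _ _ [].
by rewrite cardE.
Qed.

Lemma enum_incident_label (U : ugraph V) v e :
  e \in enum_fset (incident (lab U) v) ->
  e.1 \in uincident U v /\ e.2 = heaviest E w e.1.
Proof. by case: e => e h; rewrite mem_incident_label => /andP[-> /eqP->]. Qed.

Lemma enum_incident_label1 (U : ugraph V) v e :
  enum_fset (incident (lab U) v) = [:: e] ->
  uincident U v = [set e.1] /\ e.2 = heaviest E w e.1.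
Proof.
move=> enumE; have [|eU ->] := @enum_incident_label U v e.
  by rewrite enumE mem_head.
split=> //; apply/eqP; rewrite eq_sym eqEcard sub1set eU cards1.
by rewrite -(size_incident_label U v) enumE.
Qed.

(** The label is a function of the edge, so distinct weighted edges are distinct edges: a labelled
    graph has no parallel edges. *)
Lemma enum_incident_label2 (U : ugraph V) v e f :
  enum_fset (incident (lab U) v) = [:: e; f] ->
  [/\ uincident U v = [set e.1; f.1], e.1 != f.1, e.2 = heaviest E w e.1
    & f.2 = heaviest E w f.1].
Proof.
move=> enumE; have [|eU eh] := @enum_incident_label U v e.
  by rewrite enumE mem_head.
have [|fU fh] := @enum_incident_label U v f.
  by rewrite enumE !inE eqxx orbT.
have nef : e.1 != f.1.
  have := fset_uniq (incident (lab U) v); rewrite enumE /= inE andbT.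
  by apply: contra => /eqP ef; rewrite [e]surjective_pairing [f]surjective_pairing eh fh ef.
split=> //; apply/eqP; rewrite eq_sym eqEcard subUset !sub1set eU fU cards2 nef.
by rewrite -(size_incident_label U v) enumE.
Qed.

(** * Splicing and pruning labelled skeletons *)

Variable (S : {set V}).

Lemma splice_out_skel (K : {set V}) v : median_closed K -> v \in K ->
  splice_out S (lab (skel K)) v =
  if (v \notin S) && (#|nbrs K v| == 2) then lab (skel (K :\ v)) else lab (skel K).
Proof.
move=> mK vK; rewrite /splice_out -card_uincident_skel -size_incident_label.
move eqs: (enum_fset _) => s; case: s eqs => [|e [|f [|g s]]] /=; rewrite ?andbF //.
move=> enumE; rewrite andbT; case: (v \notin S) => //.
have [uE nef eh fh] := enum_incident_label2 enumE.
have deg : #|nbrs K v| = 2 by rewrite -card_uincident_skel uE cards2 nef.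
have [a [b [aN bN nab {uE}uE]]] : exists a b, [/\ a \in nbrs K v, b \in nbrs K v,
    a != b & e.1 = [set v; a] /\ f.1 = [set v; b]].
  have: e.1 \in uincident (skel K) v by rewrite uE set21.
  have: f.1 \in uincident (skel K) v by rewrite uE set22.
  rewrite uincident_skel => /imsetP[b bN fE] /imsetP[a aN eE].
  by exists a, b; split=> //; apply: contraNneq nef => ab; rewrite fE eE ab.
have [nav _ _ _] := nbrsP _ _ _ aN; have [nbv _ _ _] := nbrsP _ _ _ bN.
have vab := nbrs_separated mK aN bN nab.
case: uE => eE fE; rewrite eh fh eE fE -heaviest_cat //.
have -> : ([set v; a] :|: [set v; b]) :\ v = [set a; b].
  apply/setP=> z; rewrite !inE; have [->|] := eqVneq z v; last by [].
  by rewrite ![v == _]eq_sym (negbTE nav) (negbTE nbv).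
apply: eq_label => // x h; rewrite in_fset1U in_fsetD /=.
rewrite mem_weighted mem_incident_label in_uincident_skel /=.
apply/orP/andP => [[/eqP[-> ->]|]|].
- split=> //; apply/(skel_edges_del _ mK vK); right; by exists a, b.
- case/andP=> + /andP[xK hE]; rewrite xK hE andbT => nvx; split=> //.
  by apply/(skel_edges_del _ mK vK); left.
case=> /(skel_edges_del _ mK vK)[[xK vx] hE|].
  by right; rewrite xK hE (negbTE vx).
case=> a' [b' [a'N b'N nab' ->]] /eqP->; left; apply/eqP.
(* [v] has no neighbours besides [a] and [b], so any pair of distinct ones is this pair. *)
suff -> : [set a'; b'] = [set a; b] by [].
apply/eqP; rewrite eqEcard !cards2 nab nab' andbT.
have nE : nbrs K v = [set a; b].
  by apply/eqP; rewrite eq_sym eqEcard subUset !sub1set aN bN cards2 nab deg.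
by rewrite -nE subUset !sub1set a'N b'N.
Qed.

Lemma prune_marked G v : v \in S -> prune (W := W) S G v = G.
Proof.
move=> vS; rewrite /prune /splice_out vS /=.
by case: (enum_fset _) => [//|e [//|f [//|]]].
Qed.

Lemma prune_not_leaf (K : {set V}) v :
    median_closed K -> v \in K -> v \notin S -> 1 < #|nbrs K v| ->
  prune S (lab (skel K)) v =
  if #|nbrs K v| == 2 then lab (skel (K :\ v)) else lab (skel K).
Proof.
move=> mK vK vS; have := splice_out_skel mK vK; rewrite vS /= => <-.
rewrite -card_uincident_skel -size_incident_label /prune /splice_out vS.
by case: (enum_fset _) => [//|e [//|f [//|]]].
Qed.

Lemma prune_leaf (K : {set V}) v u :
    median_closed K -> v \in K -> v \notin S -> nbrs K v = [set u] ->
  prune S (lab (skel K)) v = splice_out S (lab (skel (K :\ v))) u.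
Proof.
move=> mK vK vS nE; have uN : u \in nbrs K v by rewrite nE set11.
have [nuv _ _ _] := nbrsP _ _ _ uN.
have deg : #|nbrs K v| = 1 by rewrite nE cards1.
have: size (enum_fset (incident (lab (skel K)) v)) = 1.
  by rewrite size_incident_label card_uincident_skel.
rewrite /prune vS; move enumE: (enum_fset _) => s.
case: s enumE => [|e [|f s]] // enumE _.
have [uE eh] := enum_incident_label1 enumE.
have eE : e.1 = [set v; u].
  apply/set1P; rewrite -(imset_set1 (fun z => [set v; z])) -nE -uincident_skel.
  by rewrite uE set11.
have -> : e.1 :\ v = [set u].
  apply/setP=> z; rewrite eE !inE; have [->|] := eqVneq z v; last by [].
  by rewrite eq_sym (negbTE nuv).
case: pickP => [u'|/(_ u)]; rewrite !inE ?eqxx // => /eqP->; congr splice_out.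
apply: eq_label => // x h; rewrite in_fsetD1 /= mem_weighted /=.
rewrite skel_del_leaf ?deg // in_setD uE inE.
case xK: (x \in _); rewrite ?andbF //= andbT.
have [->|nh] := eqVneq h; rewrite ?andbF // !andbT.
congr (~~ _); rewrite [e]surjective_pairing eh xpair_eqE.
by case: eqVneq => [->|//]; rewrite eqxx.
Qed.
(** * Pruning a vertex that is no longer a terminal *)

Lemma seg_concat x y z t :
  y \in seg x z -> z \in seg y t -> y != z -> y \in seg x t.
Proof.
by move=> yxz zyt nyz; apply: (subsetP (seg_sub (seg_trans yxz zyt nyz))).
Qed.

(** Terminals may be moved by [f] without losing the median [z], as long as [z] stays between every
    pair that it separated. *)
Lemma mem_junctions_map (A B : {set V}) (f : V -> V) z :
    (forall x, x \in A -> f x \in B) ->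
    (forall x y, x \in A -> y \in A -> z \in seg x y -> z \in seg (f x) (f y)) ->
  z \in junctions A -> z \in junctions B.
Proof.
move=> AB fz /junctionsP[x [y [t [[xA yA tA] [zxy zyt zxt]]]]].
apply/junctionsP; exists (f x), (f y), (f t); split; first by split; apply: AB.
by split; apply: fz.
Qed.

Lemma mem_junctions_subst (A : {set V}) v s z :
    s \in A -> z != v -> (forall x, z \in seg x v -> z \in seg x s) ->
  z \in junctions (v |: A) -> z \in junctions A.
Proof.
move=> sA nzv zs; apply: (@mem_junctions_map _ _ (fun x => if x == v then s else x)).
  by move=> x; rewrite in_setU1; case: eqP.
move=> x y _ _; have [->|nx] := eqVneq x v; have [->|ny] := eqVneq y v => //.
- by rewrite segxx inE (negbTE nzv).
- by rewrite segC => /zs; rewrite segC.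
- exact: zs.
Qed.

(** Of the three terminals around [z] at most one is [v], since [z] is not on the trivial path at
    [v]; the other two are in [A]. *)
Lemma junctions_setU1_hull (A : {set V}) v z :
  z \in junctions (v |: A) -> z != v -> z \in hull A.
Proof.
move=> /junctionsP[x [y [t [[]]]]]; rewrite !in_setU1 => xA yA tA [zxy zyt zxt] nzv.
have [ex|nx] := eqVneq x v.
  have ny : y != v by apply: contraNneq nzv => ey; rewrite ex ey segxx inE in zxy.
  have nt : t != v by apply: contraNneq nzv => et; rewrite ex et segxx inE in zxt.
  by rewrite (negbTE ny) in yA; rewrite (negbTE nt) in tA; apply/hullP; exists y, t.
rewrite (negbTE nx) in xA; have [ey|ny] := eqVneq y v; last first.
  by rewrite (negbTE ny) in yA; apply/hullP; exists x, y.
have nt : t != v by apply: contraNneq nzv => et; rewrite ey et segxx inE in zyt.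
by rewrite (negbTE nt) in tA; apply/hullP; exists x, t.
Qed.

Lemma median_degree3 (K M : {set V}) v :
    median_closed K -> median_closed M -> K :\ v \subset M -> 2 < #|nbrs K v| ->
  v \in M.
Proof.
move=> mK mM /subsetP sub /card_gt2P[a [b [c [[aN bN cN] [nab nbc nca]]]]].
have inM x : x \in nbrs K v -> x \in M.
  by case/nbrsP=> nxv _ xK _; apply: sub; rewrite !inE nxv.
have sep := nbrs_separated mK; apply: (mM a b c); do ?exact: inM; apply: sep => //.
by rewrite eq_sym.
Qed.

(** * Junctions after dropping the terminal [v] *)

Section RemoveTerminal.

Variables (A : {set V}) (v : V).
Hypothesis vA : v \notin A.
Let K := junctions (v |: A).

Let mK : median_closed K. Proof. exact: median_closed_junctions. Qed.
Let vK : v \in K. Proof. by apply: (subsetP (sub_junctions _)); rewrite setU11. Qed.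
Let AK : A \subset K.
Proof. by apply: subset_trans (sub_junctions _); rewrite subsetUr. Qed.
Let jK : junctions A \subset K. Proof. exact: junctions_min. Qed.

Let behind z : z \in K -> z != v -> exists2 s, s \in A & z \in seg v s.
Proof. by move=> zK /(junctions_setU1_hull zK) /hull_behind. Qed.

(** As [v] has two neighbours, one of them, [c], lies across [v] from [z]. A terminal behind [c] can
    stand in for [v] in the triple defining [z]. *)
Lemma junctions_del_branching : 1 < #|nbrs K v| -> K :\ v \subset junctions A.
Proof.
case/card_gt1P=> a [b [aN bN nab]]; apply/subsetP=> z; rewrite in_setD1 => /andP[nzv zK].
have [c [cN cz]] : exists c, c \in nbrs K v /\ v \in seg z c.
  have [u uN uz] := nbr_toward vK zK nzv.
  have other c : c \in nbrs K v -> u != c -> v \in seg z c.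
    move=> cN nuc; have := nbrs_separated mK uN cN nuc => vuc.
    have [nuv _ _ _] := nbrsP _ _ _ uN; have [ncv _ _ _] := nbrsP _ _ _ cN.
    by apply: seg_extend vuc uz (seg_r _ _) nuv ncv.
  have [ua|nua] := eqVneq u a; last by exists a; split; last exact: other.
  by exists b; split=> //; apply: other; rewrite ?ua.
have [ncv _ cK _] := nbrsP _ _ _ cN; have [s sA cs] := behind cK ncv.
apply: (mem_junctions_subst sA nzv _ zK) => x zx.
apply: (seg_concat zx _ nzv); rewrite segC.
by apply: seg_trans (_ : c \in seg s v) _ ncv; rewrite segC.
Qed.

Lemma nbr_junction_degree : v \in junctions A -> 2 < #|nbrs K v|.
Proof. exact: junction_degree. Qed.

Variable u : V.
Hypothesis nbrsE : nbrs K v = [set u].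

Let uK : u \in K :\ v.
Proof.
have: u \in nbrs K v by rewrite nbrsE set11.
by case/nbrsP=> nuv _ uK _; rewrite in_setD1 nuv.
Qed.

(** Seen from [v], all other vertices of [K] lie at or behind its only neighbour [u]. *)
Let on_way z x : z \in K -> z != v -> z \in seg x v -> z \in seg x u.
Proof.
move=> zK nzv; rewrite segC => zx; have [c] := nbr_toward vK zK nzv.
by rewrite nbrsE inE => /eqP-> uz; rewrite segC; apply: seg_mid zx uz.
Qed.

(** By [on_way] the terminal [u] can stand in for [v] in every triple. *)
Lemma junctions_del_leaf : u \in A -> junctions A = K :\ v.
Proof.
move=> uA; apply/eqP; rewrite eqEsubset subsetD1 jK /=; apply/andP; split.
  by apply/negP=> /nbr_junction_degree; rewrite nbrsE cards1.
apply/subsetP=> z; rewrite in_setD1 => /andP[nzv zK].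
by apply: (mem_junctions_subst uA nzv _ zK) => x; apply: on_way.
Qed.

(** For vertices other than [u], a terminal behind [u] stands in for [v]. The vertex [u] is in the
    hull of [A], so it keeps at least two neighbours, and it stays a junction exactly when it keeps
    more. *)
Lemma junctions_del_leaf_nbr : u \notin A ->
  junctions A = if #|nbrs (K :\ v) u| == 2 then K :\ v :\ u else K :\ v.
Proof.
move=> uA; have vJ : v \notin junctions A.
  by apply/negP=> /nbr_junction_degree; rewrite nbrsE cards1.
have uH : u \in hull A.
  by move: uK; rewrite in_setD1 => /andP[nuv /junctions_setU1_hull]; apply.
have sub : K :\ v :\ u \subset junctions A.
  apply/subsetP=> z; rewrite !in_setD1 => /and3P[nzu nzv zK].
  have [s sA us] := hull_behind z uH.
  apply: (mem_junctions_subst sA nzv _ zK) => x zx.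
  exact: seg_concat (on_way zK nzv zx) us nzu.
have mKv : median_closed (K :\ v) by apply: median_closed_del; rewrite ?nbrsE ?cards1.
have AKv : A \subset K :\ v by rewrite subsetD1 AK.
have jKv : junctions A \subset K :\ v by rewrite subsetD1 jK.
case: eqP => deg; apply/eqP; rewrite eqEsubset.
  rewrite sub andbT subsetD1 jKv /=; apply/negP=> /(junction_degree AKv uK uA).
  by rewrite deg.
rewrite jKv -(setD1K uK) subUset sub sub1set andbT /=.
apply: (median_degree3 mKv _ sub); first exact: median_closed_junctions.
rewrite ltn_neqAle (hull_degree AKv uK uA uH) andbT eq_sym.
exact/eqP.
Qed.

End RemoveTerminal.

(* The last hypothesis, which boundary vertices of a cluster satisfy, keeps prune
   from splicing out an unmarked terminal next to v. *)
Lemma prune_junctions (A : {set V}) v :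
    A != set0 -> (v \in A) = (v \in S) -> S :&: hull (v |: A) \subset v |: A ->
    (forall u x y, u \in A -> u \notin S -> x \in hull (v |: A) ->
       y \in hull (v |: A) -> u \in seg x y -> u = x \/ u = y) ->
  prune S (lab (skel (junctions (v |: A)))) v = lab (skel (junctions A)).
Proof.
move=> A0 vAS /subsetP marked ends; case vS: (v \in S).
  have -> : v |: A = A by apply/setUidPr; rewrite sub1set vAS.
  exact: prune_marked.
set K := junctions _; have vA : v \notin A by rewrite vAS vS.
have mK : median_closed K by apply: median_closed_junctions.
have vK : v \in K by apply: (subsetP (sub_junctions _)); rewrite setU11.
have AK : A \subset K by apply: subset_trans (sub_junctions _); rewrite subsetUr.
have jK : junctions A \subset K by apply: junctions_min.
have [deg|deg] := ltnP 1 #|nbrs K v|.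
  rewrite prune_not_leaf ?vS //; have sub := junctions_del_branching deg.
  case: eqP => deg2; congr (lab (skel _)); apply/eqP; rewrite eqEsubset.
    rewrite sub subsetD1 jK; apply/negP=> /(nbr_junction_degree vA).
    by rewrite deg2.
  rewrite jK andbT -(setD1K vK) subUset sub andbT sub1set.
  apply: (median_degree3 mK _ sub); first exact: median_closed_junctions.
  by rewrite ltn_neqAle deg andbT eq_sym; apply/eqP.
(* A terminal exists, so [v] has a neighbour in its direction and its degree is exactly one. *)
have [u nE] : exists u, nbrs K v = [set u].
  apply/cards1P; rewrite eqn_leq deg /=; have [x xA] := set0Pn _ A0.
  have nxv : x != v by apply: contraNneq vA => <-.
  have [u uN _] := nbr_toward vK (subsetP AK _ xA) nxv.
  by apply/card_gt0P; exists u.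
have uN : u \in nbrs K v by rewrite nE set11.
have [nuv _ uK _] := nbrsP _ _ _ uN; have uKv : u \in K :\ v by rewrite in_setD1 nuv.
have mKv : median_closed (K :\ v) by apply: median_closed_del => //; apply: leq_trans deg _.
rewrite (prune_leaf mK vK _ nE) ?vS // splice_out_skel //.
have [uA|uA] := boolP (u \in A); last first.
  (* Marked vertices of the hull are terminals, so [u] is unmarked and [prune] may splice it out. *)
  have uS : u \notin S.
    apply: contra uA => uS; have uH := subsetP (junctions_sub_hull _) _ uK.
    by have := marked u; rewrite in_setI uS uH in_setU1 (negbTE nuv); apply.
  by rewrite (junctions_del_leaf_nbr vA nE uA) uS -/K /=; case: (#|_| == 2).
rewrite (junctions_del_leaf vA nE uA); case: ifP => // /andP[uS /eqP degu].
(* An unmarked terminal [u] with two neighbours would lie strictly between them, against [ends]. *)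
have /card_gt1P[a [b [aN bN nab]]] : 1 < #|nbrs (K :\ v) u| by rewrite degu.
have uab := nbrs_separated mKv aN bN nab.
have inH c : c \in nbrs (K :\ v) u -> u != c /\ c \in hull (v |: A).
  case/nbrsP=> ncu _; rewrite in_setD1 => /andP[_ /(subsetP (junctions_sub_hull _)) cH] _.
  by rewrite eq_sym.
have [[nua aH] [nub bH]] := (inH a aN, inH b bN).
by case: (ends u a b uA uS aH bH uab) => /eqP; rewrite ?(negbTE nua) ?(negbTE nub).
Qed.
(** * Gluing at a cut vertex *)

Section Gluing.

(** The convex pieces [F i], with terminals [T i], hang together only at [v]. *)
Variables (I : eqType) (r : seq I) (T F : I -> {set V}) (v : V).
Hypothesis TF : forall i, i \in r -> T i \subset F i.
Hypothesis convexF : forall i x y,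
  i \in r -> x \in F i -> y \in F i -> seg x y \subset F i.
Hypothesis sepF : forall i j x y,
  i \in r -> j \in r -> i != j -> x \in F i -> y \in F j -> v \in seg x y.
(** The second alternative admits the vertex leaf of an unmarked representative, whose span is [v]
    alone and which has no terminals. *)
Hypothesis vF : forall i, i \in r -> v \in T i \/ F i \subset [set v].
Hypothesis vT : exists2 i, i \in r & v \in T i.

Let A := \bigcup_(i <- r) T i.

Let subA i : i \in r -> T i \subset A.
Proof. by move=> ir; apply/subsetP=> x xT; apply/bigcup_seqP; exists i. Qed.

Let junctionsF i : i \in r -> junctions (T i) \subset F i.
Proof.
move=> ir; apply: subset_trans (junctions_sub_hull _) _; apply/subsetP=> z.
case/hullP=> x [y [xT yT]]; apply/subsetP/convexF => //.
  by apply: (subsetP (TF ir)).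
by apply: (subsetP (TF ir)).
Qed.

Let vT_of i x : i \in r -> x \in F i -> x != v -> v \in T i.
Proof. by move=> /vF[//|/subsetP sub] /sub; rewrite inE => ->. Qed.

(** A junction [z] other than [v] lies in some piece [F i]; from [z], every terminal outside [T i]
    is seen behind [v], so [v] replaces it. *)
Lemma junctions_glue : junctions A = \bigcup_(i <- r) junctions (T i).
Proof.
apply/setP=> z; apply/idP/bigcup_seqP=> [zA|[i ir]]; last first.
  by apply/subsetP/junctions_mono/subA.
have [->|nzv] := eqVneq z v.
  by case: vT => i ir vi; exists i; rewrite // (subsetP (sub_junctions _)).
have [i ir zi] : exists2 i, i \in r & z \in F i.
  have [x [y [/bigcup_seqP[i ir xi] /bigcup_seqP[j jr yj]]]] :=
    hullP _ _ (subsetP (junctions_sub_hull _) _ zA).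
  have := subsetP (TF ir) _ xi; have := subsetP (TF jr) _ yj => {xi yj} yj xi zxy.
  have [ij|nij] := eqVneq i j.
    rewrite -ij in yj; exists i => //.
    exact: (subsetP (convexF ir xi yj)).
  have vT' k u : k \in r -> u \in F k -> z \in seg u v -> z \in F k.
    move=> kr uk; have [vk|sub] := vF kr.
      by move=> zs; apply: (subsetP (convexF kr uk (subsetP (TF kr) _ vk))).
    have /set1P-> := subsetP sub _ uk.
    by rewrite segxx inE (negbTE nzv).
  have := subsetP (seg_triangle x y v) _ zxy; rewrite inE => /orP[zx|zy].
    by exists i => //; apply: vT' zx.
  by exists j => //; apply: (vT' j y) => //; rewrite segC.
have vi := vT_of ir zi nzv; exists i => //.
have far x : x \in A -> x \notin T i -> v \in seg z x.
  case/bigcup_seqP=> j jr xj xi; apply: (sepF ir jr _ zi (subsetP (TF jr) _ xj)).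
  by apply: contraNneq xi => ->.
apply: (@mem_junctions_map A _ (fun x => if x \in T i then x else v)) zA.
  by move=> x _; case: ifP.
have key x y : x \in A -> y \in A -> z \in seg x y ->
    z \in seg (if x \in T i then x else v) y.
  move=> xA yA zxy; case: ifP => // /negbT /(far _ xA); rewrite segC => vxz.
  exact: seg_mid zxy vxz.
move=> x y xA yA /(key _ _ xA yA); case: (y \in T i) (far y yA) => // /(_ isT) vzy.
rewrite segC => zy; rewrite segC; apply: seg_mid zy _; by rewrite segC.
Qed.

(** Between vertices of different pieces lies [v], so an edge joining them ends at [v], which is
    also a terminal of the piece of its other end. *)
Lemma skel_edges_glue :
  skel_edges (junctions A) = \bigcup_(i <- r) skel_edges (junctions (T i)).
Proof.
have vi_of i : i \in r -> v \in T i -> v \in junctions (T i).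
  by move=> ir; apply/subsetP/sub_junctions.
have vA : v \in junctions A.
  by case: vT => i ir vi; apply: (subsetP (sub_junctions _)); apply: (subsetP (subA ir)).
apply/setP=> e; apply/idP/bigcup_seqP=> [eA|[i ir /= ei]].
  have [x [y exy]] := skel_edge_ends eA; rewrite exy in eA *.
  have [nxy xA yA /subsetP sub] := skel_edges2P _ _ _ eA.
  suff [i ir [xi yi]] : exists2 i, i \in r
      & x \in junctions (T i) /\ y \in junctions (T i).
    exists i; first exact: ir.
    apply/skel_edges2P; split; [exact: nxy | exact: xi | exact: yi |].
    apply/subsetP=> z.
    rewrite inE => /andP[zi zs]; apply: sub; rewrite inE zs andbT.
    exact: (subsetP (junctions_mono (subA ir))).
  have := xA; rewrite junctions_glue => /bigcup_seqP[i ir xi].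
  have := yA; rewrite junctions_glue => /bigcup_seqP[j jr yj].
  have [ij|nij] := eqVneq i j; first by exists i; rewrite // {2}ij.
  have xF := subsetP (junctionsF ir) _ xi; have yF := subsetP (junctionsF jr) _ yj.
  have := sub v; rewrite in_setI in_set2 vA (sepF ir jr nij xF yF).
  move=> /(_ isT)/orP[]/eqP vE.
    exists j => //; split=> //; rewrite -vE; apply: vi_of => //.
    by apply: vT_of yF _ => //; rewrite vE eq_sym.
  exists i => //; split=> //; rewrite -vE; apply: vi_of => //.
  by apply: vT_of xF _ => //; rewrite vE.
have [x [y exy]] := skel_edge_ends ei; rewrite exy in ei *.
have [nxy xi yi /subsetP sub] := skel_edges2P _ _ _ ei.
have /subsetP up := junctions_mono (subA ir).
apply/skel_edges2P; split; [by [] | exact: up | exact: up |].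
apply/subsetP=> z; rewrite inE => /andP[zA zs].
apply: sub; rewrite inE zs andbT; move: zA; rewrite junctions_glue.
case/bigcup_seqP=> j jr zj; have [<-//|nij] := eqVneq j i.
have /subsetP Fi := junctionsF ir.
have zi : z \in F i by apply: (subsetP (convexF ir (Fi _ xi) (Fi _ yi))).
(* Conversely, a vertex [z] common to two pieces is separated from itself by [v], hence equals
   [v]. *)
have := sepF jr ir nij (subsetP (junctionsF jr) _ zj) zi.
rewrite segxx => /set1P <-; apply: vi_of => //.
have [xv|nxv] := eqVneq x v; last exact: vT_of (Fi _ xi) nxv.
by apply: vT_of (Fi _ yi) _ => //; rewrite -xv eq_sym.
Qed.

End Gluing.

(** * Clusters *)

Lemma seg_in_edge e a b : e \in E -> a \in e -> b \in e -> seg a b \subset [set a; b].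
Proof.
have small z : seg z z \subset [set z; z] by rewrite segxx subsetUl.
case/edgeP=> x [y [xy ->]]; rewrite !in_set2.
move=> /orP[]/eqP-> /orP[]/eqP->; rewrite ?small ?(seg_adj xy) ?subxx //.
by rewrite segC (seg_adj xy) setUC subxx.
Qed.

Implicit Types X Y : {set V + {set V}}.

(** A cluster may contain edges without their ends; adding the boundary yields a vertex set that is
    convex in the tree. *)
Definition cluster_span X : {set V} := [set x | inl x \in X] :|: boundary X.

Lemma in_cluster_span X x :
  (x \in cluster_span X) = (inl x \in X) || (x \in boundary X).
Proof. by rewrite in_setU in_set. Qed.

(* Holds for all clusters of an RC tree of the whole tree but the vertex leaves. *)
Definition edge_closed X :=
  forall x e, inl x \in X -> e \in E -> x \in e -> inr e \in X.

Definition edges_from_tree X := forall e, inr e \in X -> e \in E.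

Lemma boundaryP X x :
  reflect (inl x \notin X /\ exists2 e, inr e \in X & x \in e) (x \in boundary X).
Proof.
rewrite inE; apply: (iffP andP) => -[xX].
  by case/existsP=> e /andP[eX xe]; split=> //; exists e.
by case=> e eX xe; split=> //; apply/existsP; exists e; rewrite eX.
Qed.

Lemma span_edge X e x : inr e \in X -> x \in e -> x \in cluster_span X.
Proof.
move=> eX xe; rewrite inE inE; case xX: (inl x \in X) => //=.
by apply/boundaryP; rewrite xX; split=> //; exists e.
Qed.

(** Follow a chain of incident elements of [X] from one touching [a] to one touching [b]. It covers
    the tree path, and every vertex it passes is in [X]. *)
Lemma cluster_interior X a b z :
    connected_cluster X -> edges_from_tree X ->
    a \in cluster_span X -> b \in cluster_span X -> z \in seg a b ->
  [\/ z = a, z = b | inl z \in X].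
Proof.
move=> conn XE; pose at_ (x : V) (c : V + {set V}) :=
  match c with inl y => x == y | inr e => x \in e end.
have ex x : x \in cluster_span X -> exists2 c, c \in X & at_ x c.
  rewrite inE => /orP[|/boundaryP[_ [e eX xe]]]; last by exists (inr e).
  by rewrite inE => xX; exists (inl x) => //=.
move=> /ex[c cX ac] /ex[c' c'X bc'].
have /connectP[p pp lp] := conn c c' cX c'X; move: bc'; rewrite lp => {c' c'X lp} bc.
elim: p a c cX ac pp bc => [|c2 p IHp] a [x|e] cX /= ac pp bc zab.
- by move: zab; rewrite (eqP ac) (eqP bc) segxx inE => /eqP; constructor 1.
- have /set2P[] := subsetP (seg_in_edge (XE e cX) ac bc) _ zab.
    by constructor 1.
  by constructor 2.
- case/andP: pp => /and3P[_ c2X]; case: c2 c2X bc => // e eX bc xe pp.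
  by apply: IHp eX _ pp bc zab; rewrite /= (eqP ac).
case/andP: pp => /and3P[_ c2X]; case: c2 c2X bc => // x xX bc xe pp.
have := subsetP (seg_triangle a b x) _ zab; rewrite inE => /orP[zax|zxb].
  have /set2P[->|->] := subsetP (seg_in_edge (XE e cX) ac xe) _ zax.
    by constructor 1.
  by constructor 3.
have [->|->|zX] := IHp x (inl x) xX (eqxx x) pp bc zxb; [|by constructor 2|].
  by constructor 3.
by constructor 3.
Qed.

Lemma cluster_span_convex X a b :
    connected_cluster X -> edges_from_tree X ->
    a \in cluster_span X -> b \in cluster_span X -> seg a b \subset cluster_span X.
Proof.
move=> conn XE aX bX; apply/subsetP=> z zab.
have [->//|->//|zX] := cluster_interior conn XE aX bX zab.
by rewrite inE inE zX.
Qed.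

(** Some edge of [X] joins [a] to a vertex [p]. If [p] were not [b], then [a] would lie strictly
    between two vertices of the span and so belong to [X]. *)
Lemma boundary_edge X a b :
    connected_cluster X -> edges_from_tree X ->
    a \in boundary X -> b \in cluster_span X -> adj E a b ->
  inr [set a; b] \in X.
Proof.
move=> conn XE aB bX ab; have [aX [e eX ae]] := boundaryP _ _ aB.
have [p eap pa] : exists2 p, e = [set a; p] & adj E p a.
  have [x [y [xy exy]]] := edgeP _ (XE e eX); move: ae; rewrite exy.
  case/set2P=> ->; first by exists y; rewrite 1?adj_sym.
  by exists x; rewrite 1?setUC.
have [->|npb] := eqVneq b p; first by rewrite -eap.
have pX : p \in cluster_span X by apply: span_edge eX _; rewrite eap set22.
have apb : a \in seg p b.
  apply: seg_join => z; rewrite (seg_adj pa) (seg_adj ab) !in_set2.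
  case/orP=> /eqP-> // /orP[/eqP//|/eqP pb]; by rewrite pb eqxx in npb.
have [ap|ab'|] := cluster_interior conn XE pX bX apb.
- by have := adj_neq pa; rewrite ap eqxx.
- by have := adj_neq ab; rewrite ab' eqxx.
- by rewrite (negbTE aX).
Qed.

Lemma cluster_span_vertex v : cluster_span [set inl v] = [set v].
Proof.
apply/setP=> z; rewrite in_cluster_span !in_set1; case: (boundaryP _ z) => [[_ [e]]|_].
  by rewrite in_set1.
by rewrite orbF; apply/eqP/eqP => [[]|->].
Qed.

Definition terminals X : {set V} := [set x in S | inl x \in X] :|: boundary X.

Lemma in_terminals X x :
  (x \in terminals X) = (x \in S) && (inl x \in X) || (x \in boundary X).
Proof. by rewrite in_setU in_set. Qed.

Lemma terminals_sub X : terminals X \subset cluster_span X.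
Proof. by apply: setSU; apply/subsetP=> x; rewrite !inE => /andP[]. Qed.

(** * The children of a cluster around its representative [v] *)

Section ClusterNode.

Variables (v : V) (Xs : seq {set V + {set V}}).
Let C := \bigcup_(X <- Xs) X.
Hypothesis connXs : forall X, X \in Xs -> connected_cluster X.
Hypothesis disjXs : forall X Y, X \in Xs -> Y \in Xs -> X != Y -> [disjoint X & Y].
Hypothesis neXs : forall X, X \in Xs -> X != set0.
Hypothesis vXs : [set inl v] \in Xs.
Hypothesis boundaryXs : \bigcup_(X <- Xs) boundary X = v |: boundary C.
Hypothesis connC : connected_cluster C.
Hypothesis treeC : edges_from_tree C.
Hypothesis closedC : edge_closed C.

Let inC X c : X \in Xs -> c \in X -> c \in C.
Proof. by move=> XXs cX; apply/bigcup_seqP; exists X. Qed.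

Let vC : inl v \in C. Proof. by apply: inC vXs _; rewrite set11. Qed.

Let treeXs X : X \in Xs -> edges_from_tree X.
Proof. by move=> XXs e /(inC XXs)/treeC. Qed.

Let disjP X Y c : X \in Xs -> Y \in Xs -> X != Y -> c \in X -> c \notin Y.
Proof. by move=> XXs YXs nXY cX; rewrite (disjointFr (disjXs XXs YXs nXY)). Qed.

Let boundary_in X x : X \in Xs -> x \in boundary X -> inl x \in C -> x = v.
Proof.
move=> XXs xX xC; have: x \in v |: boundary C.
  by rewrite -boundaryXs; apply/bigcup_seqP; exists X.
by rewrite in_setU1 => /orP[/eqP//|/boundaryP[]]; rewrite xC.
Qed.

(** If [e] were in another child [Y], then [x] would be a boundary vertex of [Y] inside [C], hence
    [v]; but [v] belongs to its own leaf. *)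
Lemma child_edge_closed X : X \in Xs -> X != [set inl v] -> edge_closed X.
Proof.
move=> XXs nX x e xX eE xe; have /bigcup_seqP[Y YXs eY] := closedC (inC XXs xX) eE xe.
have [<-//|nYX] := eqVneq Y X; rewrite eq_sym in nYX.
have xY := disjP XXs YXs nYX xX.
have xv : x = v.
  by apply: boundary_in YXs _ (inC XXs xX); apply/boundaryP; split=> //; exists e.
by have := disjP XXs vXs nX xX; rewrite xv set11.
Qed.

(** A walk inside [C] from [X] to [v] must leave [X], and where it does so it enters a boundary
    vertex of [X] inside [C], which can only be [v]. *)
Lemma child_boundary X : X \in Xs -> X != [set inl v] -> v \in boundary X.
Proof.
move=> XXs nX; have [c cX] := set0Pn _ (neXs XXs).
have closedX := child_edge_closed XXs nX.
have vX : inl v \notin X by apply: disjP vXs XXs _ (set11 _); rewrite eq_sym.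
have /connectP[p pp lp] := connC (inC XXs cX) vC.
elim: p c cX pp lp => [|c2 p IHp] c cX /=; first by move=> _ vc; rewrite vc cX in vX.
case/andP=> /and3P[cC c2C cc2] pp lp; have [c2X|c2X] := boolP (c2 \in X).
  exact: IHp c2X pp lp.
(* By edge closedness the walk cannot leave [X] from a vertex to an edge, so it leaves from an edge
   to a vertex. *)
case: c c2 cX cC c2C cc2 c2X {pp lp} => [x|e] [y|f] //= cX cC c2C cc2 c2X.
  by rewrite (closedX x f cX (treeC c2C) cc2) in c2X.
have yB : y \in boundary X by apply/boundaryP; split=> //; exists e.
by rewrite -(boundary_in XXs yB c2C).
Qed.

(* Otherwise the paths from v to x and to y first part at a vertex m != v; it is on
   the boundary of both X and Y, which then share the edge between m and v. *)
Lemma children_separated X Y x y :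
    X \in Xs -> Y \in Xs -> X != Y -> x \in cluster_span X -> y \in cluster_span Y ->
  v \in seg x y.
Proof.
move=> XXs YXs nXY xX yY.
have [XL|nX] := eqVneq X [set inl v].
  by rewrite XL cluster_span_vertex in xX; rewrite (set1P xX) seg_l.
have [YL|nY] := eqVneq Y [set inl v].
  by rewrite YL cluster_span_vertex in yY; rewrite (set1P yY) seg_r.
have vBX := child_boundary XXs nX; have vBY := child_boundary YXs nY.
have sub Z : boundary Z \subset cluster_span Z by apply: subsetUr.
have vX := subsetP (sub X) _ vBX; have vY := subsetP (sub Y) _ vBY.
have [m [mxy myv mxv]] := seg_median x y v.
have [<-//|nmv] := eqVneq m v.
have mX := subsetP (cluster_span_convex (connXs XXs) (treeXs XXs) xX vX) _ mxv.
have mY := subsetP (cluster_span_convex (connXs YXs) (treeXs YXs) yY vY) _ myv.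
(* A vertex of [Z] on the boundary of [Z'] would draw an edge of [Z'] into [Z]. *)
have outside Z Z' z : Z \in Xs -> Z' \in Xs -> Z != Z' -> Z != [set inl v] ->
    z \in cluster_span Z' -> inl z \notin Z.
  move=> ZXs Z'Xs nZ nZv zZ'; apply/negP=> zZ; have := disjP ZXs Z'Xs nZ zZ.
  move: zZ'; rewrite inE inE => /orP[->//|/boundaryP[_ [e eZ' ze]]] _.
  have eZ := child_edge_closed ZXs nZv zZ (treeXs Z'Xs eZ') ze.
  by have := disjP ZXs Z'Xs nZ eZ; rewrite eZ'.
have nYX : Y != X by rewrite eq_sym.
have mX' := outside X Y m XXs YXs nXY nX mY.
have mY' := outside Y X m YXs XXs nYX nY mX.
have mBX : m \in boundary X by move: mX; rewrite inE inE (negbTE mX').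
have mBY : m \in boundary Y by move: mY; rewrite inE inE (negbTE mY').
(* A vertex strictly between [m] and [v] would belong to both of the disjoint clusters. *)
have mv : adj E m v.
  apply: adj_seg => //; apply/subsetP=> z zmv; rewrite in_set2.
  have [->|->|zX] :=
    cluster_interior (connXs XXs) (treeXs XXs) mX vX zmv; rewrite ?eqxx ?orbT //.
  have [->|->|zY] :=
    cluster_interior (connXs YXs) (treeXs YXs) mY vY zmv; rewrite ?eqxx ?orbT //.
  by have := disjP XXs YXs nXY zX; rewrite zY.
have eX := boundary_edge (connXs XXs) (treeXs XXs) mBX vX mv.
have eY := boundary_edge (connXs YXs) (treeXs YXs) mBY vY mv.
by have := disjP XXs YXs nXY eX; rewrite eY.
Qed.

Lemma terminals_node : \bigcup_(X <- Xs) terminals X = v |: terminals C.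
Proof.
apply/setP=> x; apply/bigcup_seqP/idP => [[X XXs]|].
  rewrite in_terminals in_setU1 in_terminals => /orP[/andP[xS xX]|xX].
    by rewrite xS (inC XXs xX) orbT.
  have: x \in v |: boundary C by rewrite -boundaryXs; apply/bigcup_seqP; exists X.
  by rewrite in_setU1 => /orP[->//|->]; rewrite !orbT.
rewrite in_setU1 in_terminals orbCA -in_setU1 -boundaryXs.
case/orP=> [/andP[xS /bigcup_seqP[X XXs xX]]|/bigcup_seqP[X XXs xX]].
  by exists X; rewrite // in_terminals xS xX.
by exists X; rewrite // in_terminals xX orbT.
Qed.

Lemma boundary_child : exists2 X, X \in Xs & v \in boundary X.
Proof. by apply/bigcup_seqP; rewrite boundaryXs setU11. Qed.

Lemma terminals_glue :
  skel (junctions (v |: terminals C)) =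
  UGraph (\bigcup_(X <- Xs) junctions (terminals X))
         (\bigcup_(X <- Xs) skel_edges (junctions (terminals X))).
Proof.
have subT X : X \in Xs -> terminals X \subset cluster_span X by rewrite terminals_sub.
have conv X x y : X \in Xs -> x \in cluster_span X -> y \in cluster_span X ->
    seg x y \subset cluster_span X.
  by move=> XXs; apply: cluster_span_convex; [apply: connXs | apply: treeXs].
have vF X : X \in Xs -> v \in terminals X \/ cluster_span X \subset [set v].
  move=> XXs; have [->|nX] := eqVneq X [set inl v]; [right | left].
    by rewrite cluster_span_vertex.
  by rewrite in_terminals (child_boundary XXs nX) orbT.
have vT : exists2 X, X \in Xs & v \in terminals X.
  by have [X XXs vX] := boundary_child; exists X; rewrite // in_terminals vX orbT.
rewrite -terminals_node /skel (skel_edges_glue subT conv children_separated vF vT).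
by rewrite (junctions_glue subT conv children_separated vF vT).
Qed.

(** A marked vertex makes the set of terminals nonempty. An unmarked terminal is a boundary vertex,
    hence outside [C], and so never strictly inside a path of the span. *)
Lemma prune_node : (exists2 x, x \in S & inl x \in C) ->
  prune S (lab (skel (junctions (v |: terminals C)))) v =
  lab (skel (junctions (terminals C))).
Proof.
case=> m mS mC.
have hullC : hull (v |: terminals C) \subset cluster_span C.
  have sub : v |: terminals C \subset cluster_span C.
    by rewrite subUset sub1set terminals_sub andbT inE inE vC.
  apply/subsetP=> z /hullP[x [y [/(subsetP sub) xC /(subsetP sub) yC]]].
  exact/subsetP/cluster_span_convex.
apply: prune_junctions.
- by apply/set0Pn; exists m; rewrite in_terminals mS mC.
- by rewrite in_terminals vC andbT; case: (boundaryP C v) => [[]|_]; rewrite ?vC ?orbF.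
- apply/subsetP=> x; rewrite inE => /andP[xS /(subsetP hullC)].
  rewrite in_setU1 in_terminals xS !inE /= => /orP[|]->; by rewrite ?orbT.
move=> u x y; rewrite in_terminals => /orP[/andP[->//]|uB] uS.
move=> /(subsetP hullC) xC /(subsetP hullC) yC uxy.
have [| |uC] := cluster_interior connC treeC xC yC uxy; [by left | by right |].
by case/boundaryP: uB; rewrite uC.
Qed.

End ClusterNode.
(** * Expansion of clusters *)

(** Two vertices of any triple coincide, and the median is then that vertex. *)
Lemma junctions_small (B : {set V}) : #|B| <= 2 -> junctions B = B.
Proof.
move=> cB; apply/eqP; rewrite eqEsubset sub_junctions andbT; apply/subsetP=> m.
case/junctionsP=> x [y [t [[xB yB tB] [mxy myt mxt]]]].
have [xy|nxy] := eqVneq x y; first by move: mxy; rewrite -xy segxx => /set1P->.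
have [yt|nyt] := eqVneq y t; first by move: myt; rewrite -yt segxx => /set1P->.
have [tx|ntx] := eqVneq t x; first by move: mxt; rewrite tx segxx => /set1P->.
by case/negP: cB; apply/negP; rewrite -ltnNge; apply/card_gt2P; exists x, y, t.
Qed.

Lemma skel_edges_small (B : {set V}) :
  #|B| <= 2 -> skel_edges B = if #|B| == 2 then [set B] else set0.
Proof.
move=> cB; apply/setP=> e; case: eqP => cB2; rewrite !inE; last first.
  apply/negP=> /and3P[/eqP ce /subset_leq_card + _]; rewrite ce => cB'.
  by apply: cB2; apply/eqP; rewrite eqn_leq cB.
apply/and3P/eqP => [[/eqP ce eB _]|->].
  by apply/eqP; rewrite eqEcard eB ce cB2.
rewrite cB2; split=> //; apply/forall_inP=> x _; apply/forall_inP=> y _.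
exact: subsetIl.
Qed.

Lemma label_small (B : {set V}) : #|B| <= 2 ->
  (if #|B| == 2 then WGraph B [fset (B, heaviest E w B)]%fset else WGraph B fset0) =
  lab (skel (junctions B)).
Proof.
move=> cB; rewrite junctions_small //.
have edgesB := skel_edges_small cB.
case: (#|B| == 2) edgesB => edgesB; apply: eq_label => // e h; rewrite /= edgesB.
  by rewrite in_fset1 xpair_eqE in_set1; case: eqP => // ->.
by rewrite in_fset0 in_set0.
Qed.

(** Labels depend on the edge alone, so labelling commutes with unions. *)
Lemma gunion_label (I : eqType) (s : seq I) (G : I -> ugraph V) :
  foldr (@gunion V d W) (gempty V W) [seq lab (G i) | i <- s] =
  lab (UGraph (\bigcup_(i <- s) uverts (G i)) (\bigcup_(i <- s) uedges (G i))).
Proof.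
elim: s => [|i s IHs] /=; rewrite ?IHs ?big_nil ?big_cons.
  by apply: eq_label => // e h; rewrite in_fset0 in_set0.
by apply: eq_label => // e h; rewrite in_fsetU !mem_weighted /= in_setU andb_orl.
Qed.

(** The children sit in a list, for which the generated principle gives no induction hypotheses; the
    inner fixpoint supplies them as a conjunction. *)
Fixpoint rctree_nested_ind (P : rctree V -> Prop)
    (HV : forall v, P (RCVertex v)) (HE : forall e, P (RCEdge e))
    (HN : forall v cs, foldr and True (map P cs) -> P (RCNode v cs)) c : P c :=
  match c with
  | RCVertex v => HV v
  | RCEdge e => HE e
  | RCNode v cs => HN v cs
      ((fix all_children cs := match cs return foldr and True (map P cs) with
        | [::] => I
        | c :: cs => conj (rctree_nested_ind HV HE HN c) (all_children cs)
        end) cs)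
  end.

Lemma foldr_and_nth (T : Type) (t : T) (P : T -> Prop) (s : seq T) :
  foldr and True (map P s) -> forall i, i < size s -> P (nth t s i).
Proof. by elim: s => [|a s IHs] //= [Pa /IHs Ps] []. Qed.

Lemma cluster_node v cs :
  cluster (RCNode v cs) = \bigcup_(X <- map (@cluster V) cs) X.
Proof. by rewrite /=; elim: cs => [|c cs IHcs] /=; rewrite ?big_nil ?big_cons ?IHcs. Qed.

Lemma vertex_child v cs :
  pmap (@vertex_leaf V) cs = [:: v] -> [set inl v] \in map (@cluster V) cs.
Proof.
elim: cs => [|[u|e|u ds] cs IHcs] //=; last 2 first.
- by move/IHcs; rewrite inE orbC => ->.
- by move/IHcs; rewrite inE orbC => ->.
by case=> -> _; rewrite inE eqxx.
Qed.

Lemma pairwise_neq (T : eqType) (R : rel T) (s : seq T) a b :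
  symmetric R -> pairwise R s -> a \in s -> b \in s -> a != b -> R a b.
Proof.
move=> symR; elim: s => [//|c s IHs] /= /andP[/allP Rc Rs].
rewrite !inE => /orP[/eqP->|ain] /orP[/eqP->|bin].
- by rewrite eqxx.
- by move=> _; apply: Rc.
- by move=> _; rewrite symR; apply: Rc.
- exact: IHs.
Qed.

Lemma rc_cluster_props k c : rc_clustering E k c ->
  [/\ is_cluster (cluster c), cluster c != set0 & edges_from_tree (cluster c)].
Proof.
elim/rctree_nested_ind: c => [v|e|v cs IH] /= [isC].
- by split=> //; [apply/set0Pn; exists (inl v); rewrite set11 | move=> f; rewrite in_set1].
- move=> eE; split=> //; first by apply/set0Pn; exists (inr e); rewrite set11.
  by move=> f; rewrite in_set1 => /eqP[->].
case=> _ leaf _ _ rcs; split=> //; rewrite -[foldr _ _ _]/(cluster (RCNode v cs)) cluster_node.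
  apply/set0Pn; exists (inl v); apply/bigcup_seqP; exists [set inl v]; rewrite ?set11 //.
  exact: vertex_child.
move=> e /bigcup_seqP[X /(nthP set0)[i]]; rewrite size_map => ltin <-.
rewrite (nth_map (RCVertex v)) //.
have rci := foldr_and_nth (RCVertex v) rcs ltin.
by have [_ _] := foldr_and_nth (RCVertex v) IH ltin rci; apply.
Qed.

(** The invariant of the recursion. The disjunction is what the children of an edge closed node
    satisfy: the leaf of the representative contains a vertex without its edges, all others are edge
    closed. *)
Lemma expand_cluster_skel k c :
    rc_clustering E k c ->
    edge_closed (cluster c) \/ (exists v, cluster c = [set inl v]) ->
  expand_cluster E w S c = lab (skel (junctions (terminals (cluster c)))).
Proof.
have unmarked c' : #|boundary (cluster c')| <= 2 -> ~~ marked_cluster S (cluster c') ->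
    (if #|boundary (cluster c')| == 2
     then WGraph (boundary (cluster c'))
            [fset (boundary (cluster c'), heaviest E w (boundary (cluster c')))]%fset
     else WGraph (boundary (cluster c')) fset0) =
    lab (skel (junctions (terminals (cluster c')))).
  (* Without marked vertices the terminals are the boundary, at most two vertices. *)
  move=> cB unm; have -> : terminals (cluster c') = boundary (cluster c').
    apply/setP=> x; rewrite in_terminals; case: andP => // -[xS xC].
    by case/negP: unm; apply/exists_inP; exists x.
  exact: label_small.
elim/rctree_nested_ind: c => [v|e|v cs IH] rc closed.
- have [[_ cB] _ _] := rc_cluster_props rc.
  rewrite [LHS]/=; case: ifP => [|/negbFE] m; first exact: (unmarked (RCVertex v)).
  have -> : terminals (cluster (RCVertex v)) = [set v].
    have vS : v \in S.
      by case/exists_inP: m => x xS; rewrite in_set1 => /eqP[<-].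
    apply/setP=> x; have := cluster_span_vertex v => /setP/(_ x).
    rewrite in_cluster_span in_terminals /= !in_set1 => <-.
    by have [[->]|] := eqVneq (inl x : V + {set V}) (inl v); rewrite ?vS ?andbF.
  by have := @label_small [set v]; rewrite cards1 => /(_ isT) <-.
- have [[_ cB] _ _] := rc_cluster_props rc.
  rewrite [LHS]/=; case: ifP => [|/negbFE] m; first exact: (unmarked (RCEdge e)).
  by case/exists_inP: m => x _; rewrite in_set1.
have [[connC cB] _ treeC] := rc_cluster_props rc.
rewrite [LHS]/= -[foldr _ _ _]/(cluster (RCNode v cs)).
case: ifP => [|/negbFE] m; first exact: (unmarked (RCNode v cs)).
case: rc => _ [_ leaf disj bd rcs].
set Xs := map (@cluster V) cs.
have vXs : [set inl v] \in Xs by apply: vertex_child.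
have childP X : X \in Xs -> exists2 i, i < size cs & X = cluster (nth (RCVertex v) cs i).
  case/(nthP set0) => i; rewrite size_map => ltin <-; exists i => //.
  by rewrite (nth_map (RCVertex v)).
have props X : X \in Xs -> [/\ is_cluster X, X != set0 & edges_from_tree X].
  by case/childP=> i ltin ->; apply: (rc_cluster_props (foldr_and_nth _ rcs ltin)).
have connXs X : X \in Xs -> connected_cluster X by case/props=> -[].
have neXs X : X \in Xs -> X != set0 by case/props.
have disjXs X Y : X \in Xs -> Y \in Xs -> X != Y -> [disjoint X & Y].
  by apply: pairwise_neq disj => // A B; apply: disjoint_sym.
have boundaryXs : \bigcup_(X <- Xs) boundary X = v |: boundary (\bigcup_(X <- Xs) X).
  by rewrite big_map -(cluster_node v).
rewrite cluster_node -/Xs in connC treeC m closed *.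
have closedC : edge_closed (\bigcup_(X <- Xs) X).
  (* A node is no single vertex: some child has [v] on its boundary and therefore contains an
     edge. *)
  case: closed => // -[u uE]; exfalso.
  have [X XXs /boundaryP[_ [e eX _]]] := boundary_child boundaryXs.
  have: inr e \in \bigcup_(X <- Xs) X by apply/bigcup_seqP; exists X.
  by rewrite uE in_set1.
have -> : map (expand_cluster E w S) cs =
    [seq lab (skel (junctions (terminals X))) | X <- Xs].
  rewrite -map_comp; apply: (@eq_from_nth _ (gempty V W)); rewrite !size_map // => i ltin.
  rewrite !(nth_map (RCVertex v)) //; apply: (foldr_and_nth _ IH ltin).
    exact: (foldr_and_nth _ rcs ltin).
  set X := cluster _; have XXs : X \in Xs.
    by apply/(nthP set0); exists i; rewrite ?size_map // (nth_map (RCVertex v)).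
  have [->|nX] := eqVneq X [set inl v]; [by right; exists v | left].
  exact: (child_edge_closed disjXs vXs boundaryXs closedC XXs nX).
rewrite gunion_label.
rewrite -(terminals_glue connXs disjXs neXs vXs boundaryXs connC treeC closedC).
apply: prune_node => //.
by case/exists_inP: m => x xS xC; exists x.
Qed.

End Weights.

End TreePaths.

(** * The root cluster yields the compressed path tree *)

Theorem theorem4 (V : finType) (d : Order.disp_t) (W : orderType d)
  (E : {set {set V}}) (w : {set V} -> W) (S : {set V})
  (Delta k : nat) (root : rctree V) :
  is_tree E ->
  (forall v : V, degree E v <= Delta) ->
  is_rc_tree E k root ->
  compressed_path_tree E w S (expand_cluster E w S root).
Proof.
move=> treeE _ [rc nullary allV allE].
have closed : edge_closed E (cluster root) by move=> x e _ eE _; apply: allE.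
exists (skel E (junctions E S)).
  rewrite path_union_skel //; apply: splices_out_skel => //.
  - exact: median_closed_hull.
  - exact: sub_hull.
rewrite (expand_cluster_skel treeE w S rc); last by left.
(* The root has no boundary and contains every vertex, so its terminals are the marked vertices. *)
suff -> : terminals S (cluster root) = S by [].
by apply/setP=> x; rewrite in_terminals nullary in_set0 orbF allV andbT.
Qed.
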